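(* Let $E$ and $F$ be Banach spaces, $\mathcal A$ a minimal Banach operator ideal and $T\in\mathcal L(E,F)$. Suppose that there are Banach spaces $G_1,G_2$, maps $f_1\in\mathrm{Lip}_0(E,G_1)$, $f_2\in\mathrm{Lip}_0(G_2,F)$ and an operator $R\in\mathcal A(G_1,G_2)$ such that $T=f_2\circ R\circ f_1$. Assume that $E$ is separable and that at least one of the following holds: (a) $f_2\in\mathcal W\circ\mathrm{Lip}_0(G_2,F)$; (b) $F$ is a dual space, or $E'$ has the approximation property, or $\mathcal A$ is regular. Then $T\in\mathcal A(E,F)$.
   Context: Banach spaces are real; $\mathcal L(E,F)$, $\mathcal W(E,F)$ and $\overline{\mathcal F}(E,F)$ denote the bounded linear, weakly compact linear, and approximable operators (operator-norm closure of the finite-rank operators); $J_F\colon F\to F''$ is the canonical inclusion. A Banach operator ideal $\mathcal A$ is a Banach ideal of bounded linear operators in the sense of Pietsch, with norm $\|\cdot\|_{\mathcal A}$. Its minimal kernel is $\mathcal A^{\min}=\overline{\mathcal F}\circ\mathcal A\circ\overline{\mathcal F}$, i.e. operators $R\circ S\circ U$ with $U,R$ approximable and $S\in\mathcal A$, with norm $\inf\|R\|\|S\|_{\mathcal A}\|U\|$; $\mathcal A$ is minimal if $\mathcal A=\mathcal A^{\min}$ (with equal norms). $\mathcal A$ is regular if it coincides (with equal norms) with its regular hull $\mathcal A^{\mathrm{reg}}$, which consists of all $T\colon E\to F$ with $J_F\circ T\in\mathcal A(E,F'')$, with norm $\|J_F\circ T\|_{\mathcal A}$. $\mathrm{Lip}_0(E,G)$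 is the set of Lipschitz maps $E\to G$ vanishing at $0$. $\mathcal W\circ\mathrm{Lip}_0(G_2,F)$ is the set of maps $S\circ g$ with $G$ a Banach space, $g\in\mathrm{Lip}_0(G_2,G)$, $S\in\mathcal W(G,F)$. *)

(* Defs.v *)
From HB Require Import structures.
From mathcomp Require Import all_boot all_order all_algebra.
From mathcomp Require Import all_classical all_reals all_analysis.

Set Implicit Arguments.
Unset Strict Implicit.
Unset Printing Implicit Defensive.

Import Order.TTheory GRing.Theory Num.Theory.
Import numFieldNormedType.Exports.

Local Open Scope classical_set_scope.
Local Open Scope ring_scope.

Section BoundedOperators.
Context (R : realType).
Implicit Types E F G : normedModType R.

Definition unit_ball E : set E := [set x | `|x| <= 1].
Arguments unit_ball E : clear implicits.

Definition bounded_linear E F : {pred (E -> F)} :=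
  [pred f | `[< linear f /\ continuous f >]].

Record operator E F := Operator {
  opfun :> E -> F;
  opfunP : opfun \in @bounded_linear E F }.

HB.instance Definition _ E F := [isSub for @opfun E F].
HB.instance Definition _ E F := [Choice of operator E F by <:].

Lemma operator_linear E F (T : operator E F) : linear T.
Proof. by case: T => f /= /asboolP[]. Qed.

HB.instance Definition _ E F (T : operator E F) :=
  GRing.isLinear.Build R E F *:%R (T : E -> F) (operator_linear T).

Lemma operator_continuous E F (T : operator E F) : continuous T.
Proof. by case: T => f /= /asboolP[]. Qed.

Lemma operatorP E F (S T : operator E F) : (forall x, S x = T x) -> S = T.
Proof. by move=> ST; apply/val_inj/funext. Qed.

Lemma bounded_linear_submod_closed E F : submod_closed (@bounded_linear E F).
Proof.
split.
  apply/asboolP; split; last by move=> x; exact: (@cst_continuous E F 0).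
  by move=> a x y /=; rewrite scaler0 addr0.
move=> a f g /asboolP[lf cf] /asboolP[lg cg]; apply/asboolP; split.
  move=> b x y; rewrite -[LHS]/(a *: f (b *: x + y) + g (b *: x + y)).
  rewrite -[RHS]/(b *: (a *: f x + g x) + (a *: f y + g y)).
  rewrite lf lg !scalerDr !scalerA (mulrC a b) -!addrA; congr (_ + _).
  by rewrite addrCA.
move=> x; apply: (@cvgD _ _ _ _ _ (a \*: f) g); last exact: cg.
by apply: cvgZl_tmp; exact: cf.
Qed.

HB.instance Definition _ E F := GRing.isSubmodClosed.Build R (E -> F)
  (@bounded_linear E F) (@bounded_linear_submod_closed E F).
HB.instance Definition _ E F := [SubChoice_isSubLmodule of operator E F by <:].

Definition opnorm E F (T : operator E F) : R :=
  sup [set `|T x| | x in unit_ball E].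

Lemma opnorm_has_sup E F (T : operator E F) :
  has_sup [set `|T x| | x in unit_ball E].
Proof.
split; first by exists `|T 0|, 0 => //; rewrite /unit_ball/= normr0.
have /linear_bounded_continuous/bounded_funP/(_ 1)[M TM] :=
  @operator_continuous _ _ T.
by exists M => _ [x x1 <-]; exact: TM.
Qed.

Lemma opnorm_ge0 E F (T : operator E F) : 0 <= opnorm T.
Proof.
have [_ T2] := opnorm_has_sup T.
apply: (le_trans (normr_ge0 (T 0))); apply: ub_le_sup => //.
by exists 0 => //; rewrite /unit_ball/= normr0.
Qed.

Lemma le_opnorm E F (T : operator E F) x : `|T x| <= opnorm T * `|x|.
Proof.
have [->|x0] := eqVneq x 0; first by rewrite linear0 !normr0 mulr0.
have nx0 : 0 < `|x| by rewrite normr_gt0.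
rewrite -ler_pdivrMr// mulrC.
have -> : `|x|^-1 * `|T x| = `|T (`|x|^-1 *: x)|.
  by rewrite linearZ normrZ gtr0_norm// invr_gt0.
have [_ T2] := opnorm_has_sup T; apply: ub_le_sup => //.
exists (`|x|^-1 *: x) => //.
by rewrite /unit_ball/= normrZ gtr0_norm ?invr_gt0// mulVf// gt_eqF.
Qed.

Lemma opnorm_le E F (T : operator E F) (c : R) :
  0 <= c -> (forall x, `|T x| <= c * `|x|) -> opnorm T <= c.
Proof.
move=> c0 Tc; have [T1 _] := opnorm_has_sup T.
apply: ge_sup => // _ [x x1 <-]; apply: (le_trans (Tc x)).
by rewrite ler_piMr.
Qed.

Lemma opnormD E F (S T : operator E F) : opnorm (S + T) <= opnorm S + opnorm T.
Proof.
apply: opnorm_le => [|x]; first by rewrite addr_ge0 ?opnorm_ge0.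
rewrite mulrDl; apply: (le_trans (ler_normD (S x) (T x))).
by rewrite lerD// le_opnorm.
Qed.

Lemma opnormZ E F (a : R) (T : operator E F) :
  opnorm (a *: T) = `|a| * opnorm T.
Proof.
have le b S : opnorm (b *: S) <= `|b| * @opnorm E F S.
  apply: opnorm_le => [|x]; first by rewrite mulr_ge0 ?opnorm_ge0.
  by rewrite -[(b *: S) x]/(b *: S x) normrZ -mulrA ler_wpM2l// le_opnorm.
apply/eqP; rewrite eq_le le/=.
have [->|a0] := eqVneq a 0; first by rewrite normr0 mul0r opnorm_ge0.
rewrite mulrC -ler_pdivlMr ?normr_gt0// mulrC.
by have := le a^-1 (a *: T); rewrite scalerA mulVf// scale1r normfV.
Qed.

Lemma opnorm_eq0 E F (T : operator E F) : opnorm T = 0 -> T = 0.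
Proof.
move=> T0; apply: operatorP => x; apply/eqP; rewrite -normr_le0.
by rewrite (le_trans (le_opnorm T x))// T0 mul0r.
Qed.

HB.instance Definition _ E F := Lmodule_isNormed.Build R (operator E F)
  (@opnormD E F) (@opnormZ E F) (@opnorm_eq0 E F).

End BoundedOperators.

Section OperatorConstructors.
Context (R : realType).
Implicit Types E F G : normedModType R.

Lemma id_bounded_linear E : (idfun : E -> E) \in @bounded_linear R E E.
Proof. by apply/asboolP; split => // x; exact: cvg_id. Qed.

Definition op_id E : operator E E := Operator (id_bounded_linear E).

Lemma comp_bounded_linear E F G (S : operator F G) (T : operator E F) :
  (S \o T : E -> G) \in @bounded_linear R E G.
Proof.
apply/asboolP; split=> [a x y /=|x]; first by rewrite !linearP.
by apply: continuous_comp; exact: operator_continuous.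
Qed.

Definition op_comp E F G (S : operator F G) (T : operator E F) : operator E G :=
  Operator (comp_bounded_linear S T).

Lemma bounded_linear_bound E F (f : E -> F) (c : R) :
  linear f -> (forall x, `|f x| <= c * `|x|) -> f \in @bounded_linear R E F.
Proof.
move=> lf fc; apply/asboolP; split => //.
pose g : {linear E -> F} := HB.pack f (GRing.isLinear.Build _ _ _ _ _ lf).
suff : bounded_near g (nbhs 0) by move=> /bounded_linear_continuous.
apply/linear_boundedP; exists c; split=> [|r cr x]; first by rewrite num_real.
by apply: (le_trans (fc x)); rewrite ler_wpM2r// ltW.
Qed.

End OperatorConstructors.

Section OperatorComplete.
Context (R : realType) (E : normedModType R) (F : completeNormedModType R).

Lemma operator_complete (Phi : set_system (operator E F)) :
  ProperFilter Phi -> cauchy Phi -> cvg Phi.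
Proof.
move=> PPhi cPhi.
have ball_near (e : R) : 0 < e ->
    exists S : operator E F, \forall T \near Phi, `|S - T| < e.
  move=> e0; have /cauchyP/(_ e e0)[S PS] := cPhi.
  by exists S; apply: filterS PS => T; rewrite -ball_normE.
have le_near (e : R) (S : operator E F) x : (\forall T \near Phi, `|S - T| < e) ->
    \forall T \near Phi, `|S x - (T : operator E F) x| <= e * `|x|.
  move=> ST; near=> T; have -> : S x - T x = (S - T) x by [].
  apply: (le_trans (le_opnorm _ _)); rewrite ler_wpM2r//.
  by apply/ltW; near: T.
have cvgx x : cvg ((fun T : operator E F => T x) @ Phi).
  apply: cauchy_cvg; apply: cauchy_exP => e e0.
  have x1 : 0 < `|x| + 1 by rewrite ltr_wpDl.
  have [S /(@le_near _ _ x) PS] := ball_near (e / (`|x| + 1)) (divr_gt0 e0 x1).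
  exists (S x); apply: filterS PS => T STx.
  rewrite -ball_normE/=; apply: (le_lt_trans STx).
  by rewrite mulrAC ltr_pdivrMr// ltr_pM2l// ltrDl.
pose l x := lim ((fun T : operator E F => T x) @ Phi).
have cvgl x : (fun T : operator E F => T x) @ Phi --> l x by exact: cvgx.
have ll : linear l.
  move=> a x y; apply: (cvg_lim (@norm_hausdorff _ _)) => //.
  have -> : (fun T : operator E F => T (a *: x + y)) =
      (fun T : operator E F => a *: T x + T y).
    by apply/funext => T; rewrite linearP.
  by apply: cvgD => //; exact: cvgZl_tmp.
have lbound (e : R) (S : operator E F) x : (\forall T \near Phi, `|S - T| < e) ->
    `|S x - l x| <= e * `|x|.
  move=> /(@le_near _ _ x) ST; apply/ler_addgt0Pr => d d0; near Phi => T.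
  rewrite -(subrK (T x) (S x)) -addrA; apply: (le_trans (ler_normD _ _)).
  apply: lerD; first by near: T.
  by rewrite distrC; near: T; move/cvgrPdist_le : (cvgl x); exact.
have [S1 PS1] := ball_near 1 ltr01.
have lP : l \in @bounded_linear R E F.
  apply: (@bounded_linear_bound _ _ _ _ (`|S1| + 1)) => // x.
  rewrite -[l x](subKr (S1 x)); apply: (le_trans (ler_normB _ _)).
  rewrite mulrDl lerD//; first exact: le_opnorm.
  exact: lbound.
apply/cvg_ex; exists (Operator lP : operator E F).
apply/cvgrPdist_le => e e0.
have [S PS] := ball_near (e / 2) (divr_gt0 e0 (ltr0n R 2)).
near=> T; rewrite (splitr e) -(subrKA S); apply: (le_trans (ler_normD _ _)).
apply: lerD; last by apply/ltW; near: T.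
rewrite distrC; apply: opnorm_le => [|x]; first by rewrite divr_ge0// ltW.
exact: lbound.
Unshelve. all: by end_near. Qed.

HB.instance Definition _ :=
  Uniform_isComplete.Build (operator E F) operator_complete.

End OperatorComplete.

Arguments unit_ball {R} E.
Arguments op_id {R} E.

Definition dual (R : realType) (E : normedModType R) : Type := operator E R.

HB.instance Definition _ (R : realType) (E : normedModType R) :=
  CompleteNormedModule.on (dual E).

Section CanonicalInclusion.
Context (R : realType) (F : normedModType R).

Lemma evaluation_bounded_linear (x : F) :
  ((fun phi : dual F => phi x) : dual F -> R)
    \in @bounded_linear R (dual F) R.
Proof.
apply: (@bounded_linear_bound _ _ _ _ `|x|) => [//|phi].
by rewrite mulrC; exact: le_opnorm.
Qed.

Definition evaluation (x : F) : dual (dual F) :=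
  Operator (evaluation_bounded_linear x).

Lemma evaluation_linear_bounded :
  (evaluation : F -> dual (dual F)) \in @bounded_linear R F (dual (dual F)).
Proof.
apply: (@bounded_linear_bound _ _ _ _ 1) => [a x y|x].
  by apply: operatorP => phi; exact: linearP.
rewrite mul1r; apply: opnorm_le => // phi.
by rewrite mulrC; exact: (le_opnorm phi x).
Qed.

Definition canonical_inclusion : operator F (dual (dual F)) :=
  Operator evaluation_linear_bounded.

End CanonicalInclusion.

Arguments canonical_inclusion {R} F.

(* [F] is isometrically isomorphic to the dual of some Banach space. *)
Definition dual_space (R : realType) (F : completeNormedModType R) :=
  exists (G : completeNormedModType R) (Phi : operator (dual G) F),
    (forall phi, `|Phi phi| = `|phi|) /\ (forall y, exists phi, Phi phi = y).

Section OperatorClasses.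
Context (R : realType).
Implicit Types E F G : completeNormedModType R.

(* The range lies in the span of finitely many vectors. *)
Definition finite_rank E F : set (operator E F) := [set T |
  exists (n : nat) (v : 'I_n -> F), forall x, exists c : 'I_n -> R,
    T x = \sum_(i < n) c i *: v i].

Definition approximable E F : set (operator E F) := closure (@finite_rank E F).

Definition approximation_property E := forall (K : set E) (e : R),
  compact K -> 0 < e ->
  exists2 S : operator E E, finite_rank S & forall x, K x -> `|S x - x| <= e.

(* [F] with the topology sigma(F, F'). *)
Definition weak_space F : Type := initial_topology
  ((fun x phi => phi x) : F -> {ptws dual F -> R}).

HB.instance Definition _ F := Topological.on (weak_space F).

Definition weakly_compact G F : set (operator G F) := [set S |
  precompact (S @` unit_ball G : set (weak_space F))].

Definition Lip0 E F : set (E -> F) := [set f | f 0 = 0 /\ lipschitz f].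

Definition weakly_compact_Lip0 E F : set (E -> F) := [set f |
  exists (G : completeNormedModType R) (g : E -> G) (S : operator G F),
    [/\ Lip0 g, weakly_compact S & f = S \o g]].

Definition separable E := exists2 D : set E, countable D & dense D.

End OperatorClasses.

Section OperatorIdeals.
Context (R : realType).
Implicit Types E F G : completeNormedModType R.

(* A class of operators with a function on it; [ideal_norm T] is meaningful
   only when [T] belongs to the class. *)
Record normed_class := NormedClass {
  ideal_mem :> forall E F, set (operator E F);
  ideal_norm : forall E F, operator E F -> R }.

Implicit Types A B : normed_class.

Definition eq_class A B := forall E F (T : operator E F),
  (A E F T <-> B E F T) /\ (A E F T -> ideal_norm A T = ideal_norm B T).

Definition ideal_complete A E F := forall u : nat -> operator E F,
  (forall n, A E F (u n)) ->
  (forall e, 0 < e -> exists N, forall m n, (N <= m)%N -> (N <= n)%N ->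
     ideal_norm A (u m - u n) <= e) ->
  exists2 T, A E F T & ideal_norm A (u n - T) @[n --> \oo] --> (0 : R).

Record banach_operator_ideal A : Prop := BanachOperatorIdeal {
  ideal_id : A R R (op_id R) /\ ideal_norm A (op_id R : operator R R) = 1;
  ideal0 : forall E F, A E F 0;
  idealD : forall E F (S T : operator E F), A E F S -> A E F T ->
    A E F (S + T) /\ ideal_norm A (S + T) <= ideal_norm A S + ideal_norm A T;
  idealZ : forall E F (a : R) (T : operator E F), A E F T ->
    A E F (a *: T) /\ ideal_norm A (a *: T) = `|a| * ideal_norm A T;
  ideal_norm_eq0 : forall E F (T : operator E F),
    A E F T -> ideal_norm A T = 0 -> T = 0;
  ideal_comp : forall E0 E F F0
      (V : operator F F0) (T : operator E F) (U : operator E0 E),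
    A E F T ->
    A E0 F0 (op_comp V (op_comp T U)) /\
    ideal_norm A (op_comp V (op_comp T U)) <= `|V| * ideal_norm A T * `|U|;
  ideal_complete_norm : forall E F, ideal_complete A E F }.

Definition minimal_factorization A E F (T : operator E F)
    G1 G2 (V : operator G2 F) (S : operator G1 G2) (U : operator E G1) :=
  [/\ approximable V, A G1 G2 S, approximable U &
      T = op_comp V (op_comp S U)].

Definition minimal_kernel A : normed_class := {|
  ideal_mem := fun E F => [set T |
    exists G1 G2 (V : operator G2 F) (S : operator G1 G2) (U : operator E G1),
      minimal_factorization A T V S U];
  ideal_norm := fun E F T => inf [set r : R |
    exists G1 G2 (V : operator G2 F) (S : operator G1 G2) (U : operator E G1),
      minimal_factorization A T V S U /\ r = `|V| * ideal_norm A S * `|U|] |}.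

Definition regular_hull A : normed_class := {|
  ideal_mem := fun E F => [set T |
    A E (dual (dual F)) (op_comp (canonical_inclusion F) T)];
  ideal_norm := fun E F T =>
    ideal_norm A (op_comp (canonical_inclusion F) T
                    : operator E (dual (dual F))) |}.

Definition minimal_ideal A := eq_class A (minimal_kernel A).

Definition regular_ideal A := eq_class A (regular_hull A).

End OperatorIdeals.

(* Main.v *)
Require Import Defs.
From mathcomp Require Import all_boot all_order all_algebra.
From mathcomp Require Import all_classical all_reals all_analysis.
From mathcomp Require Import ring lra.

(** Since [S = V o S0 o U] with [V] and [U] approximable, it suffices to
    linearize [f1] and [f2] around it.  For [f1], the mean over [a] of
    [(psi (f1 (a + t x) - f1 a) / t)^2] increases to a finite limit as [t]
    runs through [2^-j], and by the parallelogram law its increments control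
    the failure of additivity in [x] of the difference quotients.  Along a
    suitable ultrafilter of pairs [(2^-j, a)] they become weakly additive, and
    [U], being compact, turns them into an approximable operator [D].  Along
    the same ultrafilter the quotients of [f2] at [S (f1 a)] converge to
    [T x] at [V (S0 (D x))]; averaging them with invariant means on [E] and on
    the domain of [f2] gives an operator [L] into [F''] with
    [L o V o S0 o D = J_F o T].

    If [f2] factors through a weakly compact operator then [L] has values in
    [F]; if [F] is a dual space it is complemented in [F'']; if [A] is regular
    there is nothing more to do.  If [E'] has the approximation property, [D] is
    the limit of [D o Q] with [Q] of finite rank, and by local reflexivity the
    ideal norm of [T o Q] is bounded by a multiple of [|D o Q|], so that the
    operators [T o Q] converge to [T] in the ideal norm. *)

Set Implicit Arguments.
Unset Strict Implicit.
Unset Printing Implicit Defensive.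

Import Order.TTheory GRing.Theory Num.Theory.
Import numFieldNormedType.Exports.

Local Open Scope classical_set_scope.
Local Open Scope ring_scope.

(** * Minimal sublinear functionals and the Hahn-Banach theorem *)

Section HahnBanach.
Context (R : realType) (V : lmodType R).
Implicit Types (p : V -> R) (x y : V).

Definition sublinear p := (forall x y, p (x + y) <= p x + p y) /\
  (forall a x, 0 < a -> p (a *: x) <= a * p x).

Lemma sublinear0 p : sublinear p -> p 0 = 0.
Proof.
move=> [_ pZ]; have h2 : (0 : R) < 2 by [].
have hi : (0 : R) < 2^-1 by rewrite invr_gt0.
have := pZ 2 0 h2; have := pZ 2^-1 0 hi; rewrite !scaler0; lra.
Qed.

Lemma sublinearZ p a x : sublinear p -> 0 <= a -> p (a *: x) = a * p x.
Proof.
move=> sp; rewrite le_eqVlt => /predU1P[<-|a0].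
  by rewrite scale0r mul0r sublinear0.
apply/eqP; rewrite eq_le sp.2//=.
have := sp.2 a^-1 (a *: x); rewrite scalerA mulVf ?gt_eqF// scale1r.
by rewrite invr_gt0 => /(_ a0); rewrite mulrC ler_pdivlMr// mulrC.
Qed.

Lemma sublinear_geN p x : sublinear p -> - p (- x) <= p x.
Proof.
move=> sp; have := sp.1 x (- x); rewrite subrr sublinear0//; lra.
Qed.

(** For sublinear [p] this is again sublinear, lies below [p] (take [t = 0]), and is at most [- p y]
    at [- y] (take [t = 1]). A sublinear functional equal to all its own tilts is additive. *)
Definition tilt p y x : R :=
  inf [set p (x + t *: y) - t * p y | t in [set t | 0 <= t]].

Lemma tilt_has_inf p y x : sublinear p ->
  has_inf [set p (x + t *: y) - t * p y | t in [set t | 0 <= t]].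
Proof.
move=> sp; split; first by exists (p (x + 0 *: y) - 0 * p y), 0 => //=.
exists (- p (- x)) => _ [t /= t0 <-].
have := sp.1 (x + t *: y) (- x); rewrite addrAC subrr add0r sublinearZ//; lra.
Qed.

Lemma tilt_le p y x t : sublinear p -> 0 <= t ->
  tilt p y x <= p (x + t *: y) - t * p y.
Proof.
by move=> sp t0; apply: ge_inf; [exact: (tilt_has_inf _ _ sp).2|exists t].
Qed.

Lemma le_tilt p y x c : sublinear p ->
  (forall t, 0 <= t -> c <= p (x + t *: y) - t * p y) -> c <= tilt p y x.
Proof.
move=> sp h; apply: lb_le_inf; first exact: (tilt_has_inf _ _ sp).1.
by move=> _ [t /= t0 <-]; exact: h.
Qed.

Lemma sublinear_tilt p y : sublinear p -> sublinear (tilt p y).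
Proof.
move=> sp; split=> [x x'|a x a0].
  rewrite -lerBlDl; apply: le_tilt => // t t0.
  rewrite lerBlDl -lerBlDr; apply: le_tilt => // s s0.
  rewrite lerBlDr; apply: (le_trans (tilt_le _ _ sp (addr_ge0 s0 t0))).
  have := sp.1 (x + s *: y) (x' + t *: y).
  rewrite addrACA -scalerDl; lra.
rewrite mulrC -ler_pdivrMr//; apply: le_tilt => // t t0.
rewrite ler_pdivrMr//.
apply: (le_trans (tilt_le _ _ sp (mulr_ge0 (ltW a0) t0))).
have := sp.2 a (x + t *: y) a0; rewrite scalerDr scalerA; lra.
Qed.

(** Zorn's lemma on the sublinear functionals below [p], ordered downwards. The pointwise infimum of
    a nonempty chain is finite, each member being at least [- p (- x)], and subadditive, since of
    two members the smaller one serves both summands. *)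
Lemma minimal_sublinear p : sublinear p -> exists q, [/\ sublinear q,
  forall x, q x <= p x &
  forall r, sublinear r -> (forall x, r x <= q x) -> forall x, q x <= r x].
Proof.
move=> sp; pose T : Type := {q : V -> R | sublinear q /\ forall x, q x <= p x}.
pose le : rel T := fun q r : T => `[< forall x, sval r x <= sval q x >].
have t0 : T := exist _ p (conj sp (fun x => lexx (p x))).
have [||A tA|q qmin] := @ZL_preorder T t0 le.
- by move=> q; apply/asboolP.
- move=> q r s /asboolP qr /asboolP rs; apply/asboolP => x.
  exact: le_trans (rs x) (qr x).
- have [[q0 Aq0]|A0] := pselect (A !=set0); last first.
    by exists t0 => s As; exfalso; apply: A0; exists s.
  pose m x := inf [set sval q x | q in A].
  have lbm x : lbound [set sval q x | q in A] (- p (- x)).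
    move=> _ [[q [sq qp]] Aq <-] /=; apply: le_trans (sublinear_geN _ sq).
    by rewrite lerN2.
  have m_le x q : A q -> m x <= sval q x.
    by move=> Aq; apply: ge_inf; [exists (- p (- x)); exact: lbm|exists q].
  have glb_m x c : (forall q, A q -> c <= sval q x) -> c <= m x.
    move=> h; apply: lb_le_inf; first by exists (sval q0 x), q0.
    by move=> _ [q Aq <-]; exact: h.
  have sm : sublinear m.
    split=> [x y|a x a0].
      rewrite -lerBlDl; apply: (glb_m _ _) => q Aq.
      rewrite lerBlDl -lerBlDr; apply: (glb_m _ _) => r Ar; rewrite lerBlDr.
      have [/asboolP qr|/asboolP rq] := tA q r Aq Ar.
        apply: (le_trans (m_le _ _ Ar)).
        apply: (le_trans ((svalP r).1.1 x y)); by rewrite lerD.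
      apply: (le_trans (m_le _ _ Aq)).
      apply: (le_trans ((svalP q).1.1 x y)); by rewrite lerD.
    rewrite mulrC -ler_pdivrMr//; apply: (glb_m _ _) => q Aq; rewrite ler_pdivrMr//.
    apply: (le_trans (m_le _ _ Aq)).
    by rewrite mulrC; exact: (svalP q).1.2.
  have mp x : m x <= p x by apply: (le_trans (m_le _ _ Aq0)); exact: (svalP q0).2.
  by exists (exist _ m (conj sm mp)) => s As; apply/asboolP => x; exact: m_le.
- exists (sval q); split; [exact: (svalP q).1|exact: (svalP q).2|].
  move=> q' sq' q'q.
  have q'p x : q' x <= p x by apply: (le_trans (q'q x)); exact: (svalP q).2.
  have : le q (exist _ q' (conj sq' q'p)) by apply/asboolP.
  by move=> /qmin/asboolP.
Qed.

(* A minimal sublinear functional is linear; tilting [p] along [-b] first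
   forces the minimal functional below it to agree with [p] at [b]. *)
Lemma hahn_banach p b : sublinear p -> exists l : V -> R,
  [/\ forall a x y, l (a *: x + y) = a * l x + l y,
      forall x, l x <= p x & l b = p b].
Proof.
move=> sp; have [l [sl lt lmin]] := minimal_sublinear (sublinear_tilt b sp).
have lp x : l x <= p x.
  apply: (le_trans (lt x)); apply: (le_trans (tilt_le b x sp (lexx 0))).
  by rewrite scale0r addr0 mul0r subr0.
have ladd x y : l (x + y) = l x + l y.
  apply/eqP; rewrite eq_le sl.1/=.
  (* By minimality [l] coincides with [tilt l y]; the bound at [t = 1] then gives
     [l x + l y <= l (x + y)]. *)
  have tl z : tilt l y z <= l z.
    apply: (le_trans (tilt_le y z sl (lexx 0))).
    by rewrite scale0r addr0 mul0r subr0.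
  have := le_trans (lmin _ (sublinear_tilt y sl) tl x) (tilt_le y x sl ler01).
  by rewrite scale1r mul1r lerBrDr.
have lN x : l (- x) = - l x.
  by apply/eqP; rewrite -addr_eq0 -ladd addNr sublinear0.
exists l; split=> //.
  move=> a x y; rewrite ladd; congr (_ + _).
  have [a0|a0] := leP 0 a; first exact: sublinearZ.
  by rewrite -(opprK a) scaleNr lN sublinearZ// ?mulNr// oppr_ge0 ltW.
apply/eqP; rewrite eq_le lp/=.
have := le_trans (lt (- b)) (tilt_le b (- b) sp ler01).
by rewrite scale1r addNr mul1r sublinear0// sub0r lN lerN2.
Qed.

End HahnBanach.

(** * Norming and separating functionals *)

Section Functionals.
Context (R : realType).
Implicit Types E F : normedModType R.

Lemma ler_opnorm E F (T : operator E F) x : `|T x| <= `|T| * `|x|.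
Proof. exact: le_opnorm. Qed.

Lemma opnorm_ler E F (T : operator E F) (c : R) :
  0 <= c -> (forall x, `|T x| <= c * `|x|) -> `|T| <= c.
Proof. exact: opnorm_le. Qed.

Lemma operator_of_bound E F (f : E -> F) (c : R) :
  (forall a x y, f (a *: x + y) = a *: f x + f y) ->
  (forall x, `|f x| <= c * `|x|) -> exists T : operator E F, T =1 f.
Proof. by move=> lf bf; exists (Operator (bounded_linear_bound lf bf)). Qed.

Lemma norming_functional E (x : E) :
  exists2 phi : dual E, `|phi| <= 1 & phi x = `|x|.
Proof.
have sn : sublinear (fun x : E => `|x|).
  split=> [y z|a y a0]; first exact: ler_normD.
  by rewrite normrZ gtr0_norm.
have [l [lin ln lx]] := hahn_banach x sn.
have lN y : l (- y) = - l y.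
  have l0 : l 0 = 0.
    have := lin 1 0 0; rewrite scale1r addr0 mul1r => /eqP.
    by rewrite -[X in X == _]addr0 (inj_eq (addrI _)) eq_sym => /eqP.
  by have := lin (-1) y 0; rewrite scaleN1r mulN1r addr0 l0 addr0.
have bl y : `|l y| <= 1 * `|y|.
  by rewrite mul1r ler_norml ln andbT lerNl -lN -(normrN y).
have [phi phiE] := @operator_of_bound E R l 1 lin bl.
exists phi; last by rewrite phiE.
by apply: opnorm_ler => // y; rewrite phiE.
Qed.

Lemma functional_separation E (x : E) :
  (forall phi : dual E, phi x = 0) -> x = 0.
Proof.
move=> h; have [phi _] := norming_functional x.
by rewrite h => /esym/normr0_eq0.
Qed.

Lemma norm_le_functional E (x : E) (c : R) :
  (forall phi : dual E, `|phi| <= 1 -> `|phi x| <= c) -> `|x| <= c.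
Proof.
move=> h; have [phi phi1 phix] := norming_functional x.
by have := h _ phi1; rewrite phix normr_id.
Qed.

End Functionals.

(** * Finitely additive means on bounded functions *)

Section Means.
Context (R : realType).

Definition bounded_function (I : Type) (h : I -> R) := exists c, forall i, `|h i| <= c.

Lemma bounded_cst (I : Type) (a : R) : bounded_function (fun _ : I => a).
Proof. by exists `|a|. Qed.

Lemma boundedD (I : Type) (h k : I -> R) :
  bounded_function h -> bounded_function k -> bounded_function (fun i => h i + k i).
Proof.
move=> [c hc] [d kd]; exists (c + d) => i.
by apply: (le_trans (ler_normD _ _)); rewrite lerD.
Qed.

Lemma boundedZ (I : Type) (a : R) (h : I -> R) :
  bounded_function h -> bounded_function (fun i => a * h i).
Proof. by move=> [c hc]; exists (`|a| * c) => i; rewrite normrM ler_wpM2l. Qed.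

Lemma boundedM (I : Type) (h k : I -> R) :
  bounded_function h -> bounded_function k -> bounded_function (fun i => h i * k i).
Proof.
by move=> [c hc] [d kd]; exists (c * d) => i; rewrite normrM ler_pM.
Qed.

Lemma boundedB (I : Type) (h k : I -> R) :
  bounded_function h -> bounded_function k -> bounded_function (fun i => h i - k i).
Proof.
move=> [c hc] [d kd]; exists (c + d) => i.
by apply: (le_trans (ler_normB _ _)); rewrite lerD.
Qed.

Lemma bounded_comp (I J : Type) (g : J -> I) (h : I -> R) :
  bounded_function h -> bounded_function (fun j => h (g j)).
Proof. by move=> [c hc]; exists c. Qed.

(** A mean is a total map whose laws are required on bounded functions only, so that [lim] along an
    ultrafilter is a mean as it stands. *)
Record mean (I : Type) (m : (I -> R) -> R) : Prop := Mean {
  mean_linear : forall a h k, bounded_function h -> bounded_function k ->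
    m (fun i => a * h i + k i) = a * m h + m k;
  mean_ge0 : forall h, bounded_function h -> (forall i, 0 <= h i) -> 0 <= m h;
  mean1 : m (fun=> 1) = 1 }.

Section MeanTheory.
Variables (I : Type) (m : (I -> R) -> R).
Hypothesis mm : mean m.

Lemma mean0 : m (fun=> 0) = 0.
Proof.
have := mean_linear mm 1 (bounded_cst I 0) (bounded_cst I 0).
rewrite mulr0 addr0 mul1r; lra.
Qed.

Lemma meanZ a h : bounded_function h -> m (fun i => a * h i) = a * m h.
Proof.
move=> bh; have := mean_linear mm a bh (bounded_cst I 0); rewrite mean0 addr0.
by move=> <-; congr m; apply/funext => i; rewrite addr0.
Qed.

Lemma mean_cst a : m (fun=> a) = a.
Proof.
by rewrite -[RHS]mulr1 -(mean1 mm) -(meanZ _ (bounded_cst _ _)); congr m;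
  apply/funext => i; rewrite mulr1.
Qed.

Lemma meanD h k : bounded_function h -> bounded_function k ->
  m (fun i => h i + k i) = m h + m k.
Proof.
move=> bh bk; rewrite -[m h]mul1r -mean_linear//; congr m.
by apply/funext => i; rewrite mul1r.
Qed.

Lemma meanB h k : bounded_function h -> bounded_function k ->
  m (fun i => h i - k i) = m h - m k.
Proof.
move=> bh bk; rewrite addrC -mulN1r -mean_linear//; congr m.
by apply/funext => i; rewrite mulN1r addrC.
Qed.

Lemma le_mean h k : bounded_function h -> bounded_function k ->
  (forall i, h i <= k i) -> m h <= m k.
Proof.
move=> bh bk hk; rewrite -subr_ge0 -meanB//; apply: mean_ge0 => //.
  exact: boundedB.
by move=> i; rewrite subr_ge0.
Qed.

Lemma mean_norm_le h c : (forall i, `|h i| <= c) -> `|m h| <= c.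
Proof.
move=> hc; have bh : bounded_function h by exists c.
have [bc bc'] := (bounded_cst I (- c), bounded_cst I c).
by rewrite ler_norml; apply/andP; split; [rewrite -(mean_cst (- c))|
  rewrite -[leRHS]mean_cst]; apply: le_mean => // i;
  have := hc i; rewrite ler_norml => /andP[].
Qed.

Lemma bounded_mean (J : Type) (h : J -> I -> R) :
  bounded_function (fun p : J * I => h p.1 p.2) -> bounded_function (fun j => m (h j)).
Proof.
by move=> [c hc]; exists c => j; apply: mean_norm_le => i; exact: (hc (j, i)).
Qed.

End MeanTheory.

(** The second mean is the inner one. Means need not commute, so this product depends on the
    order. *)
Lemma mean_prod (I J : Type) (m : (I -> R) -> R) (m' : (J -> R) -> R) :
  mean m -> mean m' ->
  mean (fun h : I * J -> R => m (fun i => m' (fun j => h (i, j)))).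
Proof.
move=> mm mm'.
have bs (h : I * J -> R) i : bounded_function h -> bounded_function (fun j : J => h (i, j)).
  exact: bounded_comp.
have bi h : bounded_function h -> bounded_function (fun i : I => m' (fun j => h (i, j))).
  move=> [c hc]; exists c => i; exact: mean_norm_le.
split=> [a h k bh bk|h bh h0|].
- rewrite -(mean_linear mm a (bi _ bh) (bi _ bk)); congr m; apply/funext => i.
  by rewrite -(mean_linear mm' a (bs h i bh) (bs k i bk)).
- by apply: mean_ge0 => //; [exact: bi|move=> i; apply: mean_ge0 => //; exact: bs].
- by rewrite mean_cst// mean_cst.
Qed.

End Means.

(** * Limits along an ultrafilter as means *)

Section UltraLimits.
Context (R : realType) (I : Type) (Omega : set_system I).
Context {UO : UltraFilter Omega}.

Lemma ultra_bounded_cvg (h : I -> R) : bounded_function h -> cvg (h @ Omega).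
Proof.
move=> [c hc].
have hO : (h @ Omega) `[- c, c]%classic.
  by apply: nearW => i /=; rewrite in_itv/= -ler_norml.
have [l [_ cl]] := @segment_compact R (- c) c _ _ hO.
apply/cvg_ex; exists l; apply/cvgrPdist_lt => e e0.
have [//|Oc] := in_ultra_setVsetC [set i | `|l - h i| < e] UO.
have hb : (h @ Omega) (~` [set x | `|l - x| < e]) by exact: Oc.
have [x [hx lx]] := cl _ _ hb (nbhsx_ballx l e e0).
by exfalso; apply: hx; rewrite -ball_normE in lx.
Qed.

Lemma ultra_lim_mean : mean (fun h : I -> R => lim (h @ Omega)).
Proof.
split=> [a h k bh bk|h bh h0|].
- apply/cvg_lim => //; apply: cvgD; last exact: ultra_bounded_cvg.
  by apply: cvgM; [exact: cvg_cst|exact: ultra_bounded_cvg].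
- by apply: limr_ge; [exact: ultra_bounded_cvg|exact: nearW].
- by apply/cvg_lim => //; exact: cvg_cst.
Qed.

End UltraLimits.

(** * Amenability of abelian groups *)

Section InvariantMean.
Context (R : realType) (V : zmodType).
Implicit Types (h : V -> R) (x u : V) (s : seq V).

Definition orbit_avg n x h u : R := n.+1%:R^-1 * \sum_(k < n.+1) h (u + x *+ k).

(** The average of [h] over a Folner box: the translates of [u] by all sums of multiples [x *+ k],
    one for each entry [x] of [s], with [k <= n]. *)
Definition box_avg n s h : V -> R := foldr (fun x h' => orbit_avg n x h') h s.

Lemma orbit_avg_norm n x h c : (forall u, `|h u| <= c) ->
  forall u, `|orbit_avg n x h u| <= c.
Proof.
move=> hc u; rewrite /orbit_avg normrM normfV normr_nat ler_pdivrMl//.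
apply: (le_trans (ler_norm_sum _ _ _)).
apply: (@le_trans _ _ (\sum_(k < n.+1) c)); first exact: ler_sum.
by rewrite sumr_const card_ord mulr_natl.
Qed.

Lemma box_avg_norm n s h c : (forall u, `|h u| <= c) ->
  forall u, `|box_avg n s h u| <= c.
Proof. by move=> hc; elim: s => //= x s; exact: orbit_avg_norm. Qed.

Lemma orbit_avg_linear n x a h k u :
  orbit_avg n x (fun v => a * h v + k v) u =
  a * orbit_avg n x h u + orbit_avg n x k u.
Proof. by rewrite /orbit_avg big_split/= -mulr_sumr; ring. Qed.

Lemma box_avg_linear n s a h k u :
  box_avg n s (fun v => a * h v + k v) u = a * box_avg n s h u + box_avg n s k u.
Proof.
elim: s u => //= x s IH u; rewrite -orbit_avg_linear /orbit_avg.
by congr (_ * _); apply: eq_bigr => i _; exact: IH.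
Qed.

Lemma box_avg_ge0 n s h u : (forall v, 0 <= h v) -> 0 <= box_avg n s h u.
Proof.
move=> h0; elim: s u => //= x s IH u.
by rewrite mulr_ge0// ?invr_ge0// sumr_ge0// => i _; exact: IH.
Qed.

Lemma box_avg1 n s u : box_avg n s (fun=> 1) u = 1.
Proof.
elim: s u => //= x s IH u; rewrite /orbit_avg.
under eq_bigr do rewrite IH.
by rewrite sumr_const card_ord mulVf.
Qed.

Lemma box_avg_shift n s h x u :
  box_avg n s (fun v => h (v + x)) u = box_avg n s h (u + x).
Proof.
elim: s u => //= y s IH u; rewrite /orbit_avg; congr (_ * _).
by apply: eq_bigr => i _; rewrite IH addrAC.
Qed.

Lemma orbit_avg_invariant n x h c u : (forall v, `|h v| <= c) ->
  `|orbit_avg n x h (u + x) - orbit_avg n x h u| <= c *+ 2 / n.+1%:R.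
Proof.
move=> hc; rewrite /orbit_avg -mulrBr normrM normfV normr_nat mulrC.
rewrite ler_wpM2r ?invr_ge0// -sumrB.
rewrite (eq_bigr (fun k : 'I_n.+1 => h (u + x *+ k.+1) - h (u + x *+ k))).
  rewrite -(big_mkord xpredT (fun k => h (u + x *+ k.+1) - h (u + x *+ k))).
  rewrite telescope_sumr//.
  by apply: (le_trans (ler_normB _ _)); rewrite mulr2n lerD.
by move=> i _; rewrite -addrA -mulrS.
Qed.

Lemma box_avg_invariant n s h c x u : (forall v, `|h v| <= c) -> x \in s ->
  `|box_avg n s h (u + x) - box_avg n s h u| <= c *+ 2 / n.+1%:R.
Proof.
move=> hc; elim: s u => //= y s IH u; rewrite inE => /predU1P[<-|xs].
  by apply: orbit_avg_invariant; exact: box_avg_norm.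
have := @orbit_avg_norm n y
  (fun u => box_avg n s h (u + x) - box_avg n s h u) _ (fun u => IH u xs) u.
rewrite {1}/orbit_avg sumrB mulrBr; congr (`|_ - _| <= _).
by rewrite /orbit_avg; congr (_ * _); apply: eq_bigr => i _; rewrite addrAC.
Qed.

(** A limit of box averages along an ultrafilter on which [s] and [n] grow. Any given [x] eventually
    lies in [s], and a shift by [x] then costs at most [2 c / (n + 1)], by telescoping. *)
Lemma invariant_mean_exists : exists m : (V -> R) -> R, mean m /\
  forall h x, bounded_function h -> m (fun u => h (u + x)) = m h.
Proof.
pose D (p : seq V * nat) :=
  [set q : seq V * nat | {subset p.1 <= q.1} /\ (p.2 <= q.2)%N].
pose Phi := filter_from setT D.
have PPhi : ProperFilter Phi.
  apply: filter_from_proper; last by move=> p _; exists p; split.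
  apply: filter_from_filter; first by exists ([::], 0%N).
  move=> [s n] [t k] _ _; exists (s ++ t, maxn n k) => //.
  move=> [q l] [/= sq]; rewrite geq_max => /andP[nl kl]; split; split => //= x xs;
    by apply: sq; rewrite mem_cat xs ?orbT.
have [W [UO PO]] := ultraFilterLemma PPhi.
pose b h (p : seq V * nat) := box_avg p.2 p.1 h 0.
have bb h : bounded_function h -> bounded_function (b h).
  by move=> [c hc]; exists c => p; exact: box_avg_norm.
have ml := @ultra_lim_mean R _ W UO.
exists (fun h => lim (b h @ W)); split.
  split=> [a h k bh bk|h bh h0|].
  - rewrite -(mean_linear ml a (bb _ bh) (bb _ bk)); congr (lim (_ @ W)).
    by apply/funext => p; exact: box_avg_linear.
  - apply: (mean_ge0 ml (bb _ bh)) => p; exact: (box_avg_ge0 p.2 p.1 0 h0).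
  - rewrite -[RHS](mean1 ml); congr (lim (_ @ W)).
    by apply/funext => p; exact: box_avg1.
move=> h x bh; apply/eqP; rewrite -subr_eq0.
have bh' : bounded_function (fun u => h (u + x)) by exact: bounded_comp.
rewrite -(meanB ml (bb _ bh') (bb _ bh)); apply/eqP/cvg_lim => //.
case: bh => c hc.
apply/cvgrPdist_le => e e0.
apply: PO; exists ([:: x], Num.truncn (c *+ 2 / e)) => // -[s n] [/= xs kn].
rewrite sub0r normrN /b /= box_avg_shift.
apply: (le_trans (box_avg_invariant _ _ hc (xs x (mem_head _ _)))).
rewrite ler_pdivrMr// mulrC -ler_pdivrMr//.
apply: (le_trans (ltW (truncnS_gt _))).
by rewrite ler_nat.
Qed.

End InvariantMean.

(** * Operators from additive maps, and sums of rank-one operators *)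

Section OperatorFacts.
Context (R : realType).
Implicit Types E F G : normedModType R.

Lemma operatorD E F (T : operator E F) x y : T (x + y) = T x + T y.
Proof. exact: linearD. Qed.

Lemma operatorB E F (T : operator E F) x y : T (x - y) = T x - T y.
Proof. exact: linearB. Qed.

Lemma operatorN E F (T : operator E F) x : T (- x) = - T x.
Proof. exact: linearN. Qed.

Lemma operatorZ E F (T : operator E F) a x : T (a *: x) = a *: T x.
Proof. exact: linearZ. Qed.

Lemma operator0 E F (T : operator E F) : T 0 = 0.
Proof. exact: linear0. Qed.

Lemma operator_sum E F (T : operator E F) (I : Type) (s : seq I) (P : pred I)
    (x : I -> E) :
  T (\sum_(i <- s | P i) x i) = \sum_(i <- s | P i) T (x i).
Proof. exact: linear_sum. Qed.

Lemma functionalZ E (phi : dual E) a x : phi (a *: x) = a * phi x.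
Proof. exact: operatorZ. Qed.

Lemma functional_ext E (x y : E) : (forall phi : dual E, phi x = phi y) -> x = y.
Proof.
move=> h; apply/eqP; rewrite -subr_eq0; apply/eqP/functional_separation => phi.
by rewrite operatorB h subrr.
Qed.

(** Additivity gives homogeneity for integers. For real [a], [n] times the homogeneity defect at [a]
    is the defect at [n a] minus its integer part. That scalar has modulus at most one, so its
    defect is at most [2 c |x|] whatever [n] is, and the defect at [a] vanishes. *)
Lemma additive_bounded_scalable E F (f : E -> F) (c : R) :
  {morph f : x y / x + y} -> (forall x, `|f x| <= c * `|x|) ->
  forall a x, f (a *: x) = a *: f x.
Proof.
move=> fD fc a x.
have f0 : f 0 = 0 by apply: (addrI (f 0)); rewrite -fD !addr0.
have fN y : f (- y) = - f y.
  by apply/eqP; rewrite -addr_eq0 -fD addNr f0.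
have fn n y : f (y *+ n) = f y *+ n.
  by elim: n => [|n IH]; rewrite ?mulr0n// !mulrS fD IH.
have fz (k : int) y : f (k%:~R *: y) = k%:~R *: f y.
  case: k => n; first by rewrite -!pmulrn !scaler_nat.
  by rewrite !NegzE !mulrNz !scaleNr -!pmulrn !scaler_nat fN fn.
apply/eqP; rewrite -subr_eq0 -normr_eq0; apply/negPn/negP => z0.
have {}z0 : 0 < `|f (a *: x) - a *: f x| by rewrite lt_def z0 normr_ge0.
set z := f (a *: x) - a *: f x in z0.
pose n := (Num.truncn (c * `|x| *+ 2 / `|z|)).+1.
have : c * `|x| *+ 2 < n%:R * `|z| by rewrite -ltr_pdivrMr// truncnS_gt.
rewrite ltNge => /negP; apply.
pose k := Num.floor (n%:R * a); pose b := n%:R * a - k%:~R.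
have b1 : `|b| <= 1.
  have := floor_itv (n%:R * a); rewrite -/k intrD => /andP[k1 k2].
  by rewrite ger0_norm /b ?subr_ge0// lerBlDl ltW.
have -> : n%:R * `|z| = `|f (b *: x) - b *: f x|.
  rewrite -[n%:R]normr_nat -normrZ scalerBr; congr `|_|.
  have nab : n%:R * a = k%:~R + b by rewrite /b addrC subrK.
  rewrite scalerA nab scaler_nat -fn -scaler_nat scalerA nab.
  by rewrite !scalerDl fD fz opprD addrACA subrr add0r.
apply: (le_trans (ler_normB _ _)); rewrite mulr2n lerD//.
  apply: (le_trans (fc _)); rewrite normrZ mulrCA ler_piMl//.
  by apply: le_trans (fc x).
by rewrite normrZ; apply: le_trans (fc x); rewrite ler_piMl.
Qed.

Lemma operator_of_additive E F (f : E -> F) (c : R) :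
  {morph f : x y / x + y} -> (forall x, `|f x| <= c * `|x|) ->
  exists T : operator E F, T =1 f.
Proof.
move=> fD fc; apply: (@operator_of_bound _ _ _ _ c) => // a x y.
by rewrite fD (additive_bounded_scalable fD fc).
Qed.

Lemma lipschitz_bound E F (f : E -> F) : lipschitz f ->
  exists2 c : R, 0 <= c & forall x y, `|f x - f y| <= c * `|x - y|.
Proof.
move=> /pinfty_ex_gt0[c c0 fc]; exists c; first exact: ltW.
by move=> x y; exact: (fc (x, y)).
Qed.

Definition rank_one_fun E F (phi : dual E) (v : F) x := phi x *: v.

Lemma rank_one_bounded_linear E F (phi : dual E) (v : F) :
  rank_one_fun phi v \in @bounded_linear R E F.
Proof.
apply: (@bounded_linear_bound _ _ _ _ (`|phi| * `|v|)) => [a x y|x].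
  by rewrite /rank_one_fun linearP scalerDl scalerA.
by rewrite /rank_one_fun normrZ mulrAC ler_wpM2r// ler_opnorm.
Qed.

Definition rank_one E F (phi : dual E) (v : F) : operator E F :=
  Operator (rank_one_bounded_linear phi v).

Lemma sum_operatorE E F (I : Type) (s : seq I) (P : pred I)
    (T : I -> operator E F) x :
  (\sum_(i <- s | P i) T i) x = \sum_(i <- s | P i) T i x.
Proof. by elim/big_rec2: _ => // i y S _ <-. Qed.

Definition rank_sum E F n (phi : 'I_n -> dual E) (v : 'I_n -> F) :
  operator E F := \sum_(i < n) rank_one (phi i) (v i).

Lemma rank_sumE E F n (phi : 'I_n -> dual E) (v : 'I_n -> F) x :
  rank_sum phi v x = \sum_(i < n) phi i x *: v i.
Proof. by rewrite sum_operatorE. Qed.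

End OperatorFacts.

(** * Finite-rank and approximable operators *)

Section FiniteRank.
Context (R : realType).
Implicit Types E F G : completeNormedModType R.

Lemma rank_sum_finite_rank E F n (phi : 'I_n -> dual E) (v : 'I_n -> F) :
  finite_rank (rank_sum phi v).
Proof. by exists n, v => x; exists (phi^~ x); exact: rank_sumE. Qed.

(** The coefficients in [finite_rank] are arbitrary functions of [x]; here they become bounded
    functionals. By induction on the number of vectors: a functional equal to one at the first
    vector yields a rank-one operator whose subtraction leaves a range in the span of one vector
    fewer. *)
Lemma finite_rankE E F (T : operator E F) : finite_rank T ->
  exists n (phi : 'I_n -> dual E) (v : 'I_n -> F), T = rank_sum phi v.
Proof.
move=> [n [v]]; elim: n T v => [|n IH] T v Tv.
  exists 0%N, (fun=> 0), v; apply: operatorP => x; rewrite rank_sumE big_ord0.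
  by have [c ->] := Tv x; rewrite big_ord0.
have [v0|v0] := eqVneq (v ord0) 0.
  apply: (IH _ (fun i => v (lift ord0 i))) => x.
  have [c ->] := Tv x; exists (fun i => c (lift ord0 i)).
  by rewrite big_ord_recl v0 scaler0 add0r.
have [l _ lv] := norming_functional (v ord0).
pose l1 : dual F := `|v ord0|^-1 *: l.
have l1v : l1 (v ord0) = 1.
  by rewrite -[LHS]/(`|v ord0|^-1 * l (v ord0)) lv mulVf// normr_eq0.
pose phi : dual E := op_comp l1 T.
pose w i := v (lift ord0 i) - l1 (v (lift ord0 i)) *: v ord0.
have [|m [psi [u Tu]]] := IH (T - rank_one phi (v ord0)) w.
  move=> x; have [c Tx] := Tv x; exists (fun i => c (lift ord0 i)).
  rewrite -[LHS]/(T x - l1 (T x) *: v ord0) Tx big_ord_recl operatorD.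
  rewrite functionalZ l1v mulr1 scalerDl opprD addrACA subrr add0r operator_sum.
  rewrite scaler_suml -sumrB; apply: eq_bigr => i _.
  by rewrite /w scalerBr functionalZ scalerA.
exists m.+1, (fun i => if unlift ord0 i is Some j then psi j else phi),
  (fun i => if unlift ord0 i is Some j then u j else v ord0).
rewrite /rank_sum big_ord_recl unlift_none.
under eq_bigr do rewrite liftK.
by rewrite -/(rank_sum psi u) -Tu addrC subrK.
Qed.

Lemma finite_rankB E F (S T : operator E F) :
  finite_rank S -> finite_rank T -> finite_rank (S - T).
Proof.
move=> [n [v hv]] [m [w hw]].
exists (n + m)%N, (fun i : 'I_(n + m) =>
  match fintype.split i with inl j => v j | inr j => w j end).
move=> x; have [c cE] := hv x; have [d dE] := hw x.
exists (fun i : 'I_(n + m) =>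
  match fintype.split i with inl j => c j | inr j => - d j end).
rewrite big_split_ord/= -[LHS]/(S x - T x) cE dE -sumrN; congr (_ + _).
  by apply: eq_bigr => i _; rewrite (unsplitK (inl i)).
by apply: eq_bigr => i _; rewrite (unsplitK (inr i)) scaleNr.
Qed.

Lemma approximableP E F (T : operator E F) : approximable T <->
  forall e, 0 < e -> exists2 S, finite_rank S & `|T - S| < e.
Proof.
split=> [aT e e0|h B].
  have [S [fS]] := aT _ (nbhsx_ballx T e e0).
  by rewrite -ball_normE => TS; exists S.
move=> /nbhs_ballP[e /= e0 eB]; have [S fS TS] := h e e0.
by exists S; split => //; apply: eB; rewrite -ball_normE.
Qed.

(** Up to [e / 2] the operator is a finite sum of rank-one terms, whose coefficients are bounded
    along [p] and hence converge; so the family [U (p i)] is Cauchy along the ultrafilter. *)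
Lemma approximable_ultra_cvg E F (U : operator E F) (I : Type)
    (W : set_system I) (UW : UltraFilter W) (p : I -> E) (c : R) :
  approximable U -> (forall i, `|p i| <= c) -> cvg (U (p i) @[i --> W]).
Proof.
move=> /approximableP aU pc.
apply: cauchy_cvg; apply: cauchy_exP => e e0.
have c1 : 0 < `|c| + 1 by rewrite ltr_wpDl.
have [S /finite_rankE[n [phi [v ->]]] US] :=
  aU (e / 2 / (`|c| + 1)) (divr_gt0 (divr_gt0 e0 (ltr0n R 2)) c1).
have cphi j : cvg (phi j (p i) @[i --> W]).
  apply: ultra_bounded_cvg; exists (`|phi j| * c) => i.
  by apply: (le_trans (ler_opnorm _ _)); rewrite ler_wpM2l.
have cS : rank_sum phi v (p i) @[i --> W] -->
    \sum_(j < n) lim (phi j (p i) @[i --> W]) *: v j.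
  under eq_fun do rewrite rank_sumE.
  by apply: cvg_big => [|j _]; [exact: add_continuous|apply: cvgZr_tmp; exact: cphi].
exists (\sum_(j < n) lim (phi j (p i) @[i --> W]) *: v j).
move/cvgrPdist_lt : cS => /(_ (e / 2) (divr_gt0 e0 (ltr0n R 2))).
apply: filterS => i hi; rewrite -ball_normE/= (splitr e).
rewrite -(subrKA (rank_sum phi v (p i))); apply: (le_lt_trans (ler_normD _ _)).
apply: ltrD => //; rewrite distrC.
apply: (le_lt_trans (ler_opnorm (U - rank_sum phi v) (p i))).
have : `|p i| < `|c| + 1.
  by apply: (le_lt_trans (pc i)); apply: (le_lt_trans (ler_norm _)); rewrite ltrDl.
move=> pi1; rewrite ltr_pdivlMr// in US.
apply: le_lt_trans US; rewrite ler_wpM2l// ltW//.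
Qed.

End FiniteRank.

(** * From a mean to an ultrafilter *)

Section NullMeanFilter.
Context (R : realType) (I : Type) (m : (I -> R) -> R).

(** The sets where [h < 1], for [h >= 0] of mean zero, form a filter base: the sum of two such [h]
    gives a set inside both, and an empty set would force [1 <= m h]. As [h / e] also has mean zero,
    an ultrafilter above this base contains the sets where [h < e]. *)
Lemma null_mean_ultra : mean m -> exists W : set_system I, UltraFilter W /\
  forall h : I -> R, bounded_function h -> (forall i, 0 <= h i) -> m h = 0 ->
    h @ W --> (0 : R).
Proof.
move=> mm.
pose D := [set h : I -> R | [/\ bounded_function h, forall i, 0 <= h i & m h = 0]].
have PF : ProperFilter (filter_from D (fun h => [set i | h i < 1])).
  apply: filter_from_proper.
    apply: filter_from_filter; first by
      exists (fun=> 0); split; [exact: bounded_cst| |exact: mean0].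
    move=> h k [bh h0 mh] [bk k0 mk]; exists (fun i => h i + k i).
      split; [exact: boundedD|by move=> i; rewrite addr_ge0|].
      by rewrite meanD// mh mk addr0.
    move=> i /= hk; split => /=; apply: le_lt_trans hk; first by rewrite lerDl.
    by rewrite lerDr.
  move=> h [bh h0 mh]; apply: contrapT => /set0P/negP/negPn/eqP hN.
  have : 1 <= m h.
    rewrite -{1}(mean1 mm); apply: le_mean => // [|i]; first exact: bounded_cst.
    by rewrite leNgt; apply/negP => hi; rewrite -[False]/(set0 i) -hN.
  by rewrite mh ler10.
have [W [UW FW]] := ultraFilterLemma PF; exists W; split => // h bh h0 mh.
apply/cvgrPdist_lt => e e0; apply: FW; exists (fun i => e^-1 * h i).
  split; first exact: boundedZ.
    by move=> i; rewrite mulr_ge0// invr_ge0 ltW.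
  by rewrite meanZ// mh mulr0.
by move=> i /=; rewrite ltr_pdivrMl// mulr1 sub0r normrN ger0_norm.
Qed.

End NullMeanFilter.

(** * Dyadic difference quotients and second differences *)

Section Differences.
Context (R : realType) (E G : normedModType R) (f : E -> G).
Implicit Types (x y a : E) (j : nat).

Definition dyadic_quotient j x a : G :=
  2 ^+ j *: (f (a + 2 ^- j *: x) - f a).

Definition second_difference j x a : G :=
  dyadic_quotient j x (a + 2 ^- j *: x) - dyadic_quotient j x a.

Lemma expr2_gt0 j : 0 < (2 : R) ^+ j.
Proof. exact: exprn_gt0. Qed.

Lemma dyadic_quotient_norm c j x a :
  (forall x y, `|f x - f y| <= c * `|x - y|) ->
  `|dyadic_quotient j x a| <= c * `|x|.
Proof.
move=> fc; rewrite normrZ gtr0_norm ?expr2_gt0// -ler_pdivlMl ?expr2_gt0//.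
apply: (le_trans (fc _ _)); rewrite addrAC subrr add0r normrZ mulrCA.
by rewrite gtr0_norm// invr_gt0 expr2_gt0.
Qed.

Lemma dyadic_quotient_lipschitz c j a x y :
  (forall x y, `|f x - f y| <= c * `|x - y|) ->
  `|dyadic_quotient j x a - dyadic_quotient j y a| <= c * `|x - y|.
Proof.
move=> fc; rewrite -scalerBr opprB addrA subrK.
rewrite normrZ gtr0_norm ?expr2_gt0// -ler_pdivlMl ?expr2_gt0//.
apply: (le_trans (fc _ _)).
rewrite opprD addrACA subrr add0r -scalerBr normrZ mulrCA.
by rewrite gtr0_norm// invr_gt0 expr2_gt0.
Qed.

Lemma dyadic_quotient_half j x a : dyadic_quotient j x a =
  2^-1 *: (dyadic_quotient j.+1 x a +
           dyadic_quotient j.+1 x (a + 2 ^- j.+1 *: x)).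
Proof.
rewrite /dyadic_quotient -scalerDr scalerA exprS mulKf//; congr (_ *: _).
rewrite [RHS]addrC addrA subrK -(addrA a) -scalerDl.
by rewrite invfM -mulrDl -[2^-1]div1r -splitr mul1r.
Qed.

(** Put [s = 2 ^- j]. Second differences from [a] along [x] and [y] end at [a + 2 s x] and
    [a + 2 s y]. The one along [y - x] from the first of these points ends at the second and has
    midpoint [a + s (x + y)], so the end points cancel. *)
Lemma additivity_defect j x y a :
  dyadic_quotient j (x + y) a - dyadic_quotient j x a - dyadic_quotient j y a =
  2^-1 *: (second_difference j x a + second_difference j y a
           - second_difference j (y - x) (a + 2 ^- j *: x + 2 ^- j *: x)).
Proof.
rewrite /second_difference /dyadic_quotient.
set s := 2 ^- j; set t := 2 ^+ j.
(* Vector identities are tested on functionals, where [ring] and [field] apply. *)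
have -> : a + s *: x + s *: x + s *: (y - x) = a + s *: (x + y).
  by apply: functional_ext => phi;
    rewrite !(operatorD, operatorN, functionalZ); ring.
have -> : a + s *: (x + y) + s *: (y - x) = a + s *: y + s *: y.
  by apply: functional_ext => phi;
    rewrite !(operatorD, operatorN, functionalZ); ring.
by apply: functional_ext => phi;
  rewrite !(functionalZ, operatorD, operatorN); field.
Qed.

End Differences.

(** * Weak asymptotic additivity of the quotients of a Lipschitz map *)

Section Differentiability.
Context (R : realType) (E G : normedModType R) (f : E -> G) (c : R).
Hypothesis fc : forall x y, `|f x - f y| <= c * `|x - y|.
Implicit Types (x y a : E) (j : nat) (phi : dual G).

Local Notation q := (dyadic_quotient f).
Local Notation sd := (second_difference f).

Lemma bounded_functional_quotient phi j x :
  bounded_function (fun a => phi (q j x a)).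
Proof.
exists (`|phi| * (c * `|x|)) => a; apply: (le_trans (ler_opnorm _ _)).
by rewrite ler_wpM2l//; exact: dyadic_quotient_norm.
Qed.

Lemma bounded_functional_second_difference phi j x :
  bounded_function (fun a => phi (sd j x a)).
Proof.
rewrite /second_difference; under eq_fun do rewrite operatorB.
apply: boundedB; last exact: bounded_functional_quotient.
exact: (bounded_comp (fun a => a + 2 ^- j *: x)
  (bounded_functional_quotient phi j x)).
Qed.

Lemma bounded_sqr (I : Type) (h : I -> R) :
  bounded_function h -> bounded_function (fun i => h i ^+ 2).
Proof. by move=> bh; exact: boundedM. Qed.

Section EnergyIncrement.
Variable m : (E -> R) -> R.
Hypotheses (mm : mean m)
  (minv : forall h x, bounded_function h -> m (fun u => h (u + x)) = m h).

Let energy phi x j := m (fun a => phi (q j x a) ^+ 2).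

Let defect phi x j := m (fun a => phi (sd j x a) ^+ 2).

(* The parallelogram law: the quotient at scale [2^-j] is the midpoint of two
   translates of the quotient at scale [2^-(j+1)]. *)
Lemma defectE phi x j :
  defect phi x j.+1 = 4 * (energy phi x j.+1 - energy phi x j).
Proof.
rewrite /defect /energy.
have bq k := bounded_functional_quotient phi k x.
have bq2 k := bounded_sqr (bq k).
have bq2' := bounded_comp (fun a => a + 2 ^- j.+1 *: x) (bq2 j.+1).
have -> : (fun a => phi (sd j.+1 x a) ^+ 2) =
    fun a => 2 * (phi (q j.+1 x a) ^+ 2 +
                  phi (q j.+1 x (a + 2 ^- j.+1 *: x)) ^+ 2)
             - 4 * phi (q j x a) ^+ 2.
  apply/funext => a; rewrite [q j x a]dyadic_quotient_half (functionalZ phi 2^-1).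
  rewrite /second_difference (operatorB phi (q j.+1 x _)).
  by rewrite (operatorD phi (q j.+1 x _)); field.
rewrite meanB ?meanZ ?meanD//; [|exact: boundedD|by apply/boundedZ/boundedD|
  exact: boundedZ].
rewrite (minv (2 ^- j.+1 *: x) (bq2 j.+1)); ring.
Qed.

(** By [defectE] the energies do not decrease in [j]; the Lipschitz constant bounds them, so their
    increments tend to zero. *)
Lemma defect_cvg0 phi x : defect phi x @ \oo --> (0 : R).
Proof.
have bq2 k := bounded_sqr (bounded_functional_quotient phi k x).
have energy_nd : nondecreasing_seq (energy phi x).
  apply/nondecreasing_seqP => j; rewrite -subr_ge0 -(pmulr_rge0 _ (_ : 0 < 4))//.
  rewrite -defectE; apply: (mean_ge0 mm) => [|a]; last exact: sqr_ge0.
  exact/bounded_sqr/bounded_functional_second_difference.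
have energy_ub : has_ubound (range (energy phi x)).
  exists ((`|phi| * (c * `|x|)) ^+ 2) => _ [j _ <-].
  apply: (le_trans (ler_norm _)); apply: (mean_norm_le mm) => a.
  rewrite normrX lerXn2r ?nnegrE//.
    rewrite mulr_ge0//; apply: le_trans (dyadic_quotient_norm j x a fc).
    exact: normr_ge0.
  apply: (le_trans (ler_opnorm _ _)).
  by rewrite ler_wpM2l//; exact: dyadic_quotient_norm.
have ecvg := nondecreasing_cvgn energy_nd energy_ub.
set l := sup _ in ecvg.
have : (fun j => 4 * (energy phi x j.+1 - energy phi x j)) @ \oo
    --> 4 * (l - l).
  apply: cvgM; first exact: cvg_cst.
  by apply: cvgB => //; rewrite (cvg_shiftS (energy phi x)).
rewrite subrr mulr0 -(cvg_shiftS (defect phi x)).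
by under eq_fun do rewrite -defectE.
Qed.

(** The combination in [additivity_defect] has square at most the sum of the squares of its three
    terms, and invariance of [m] removes the translation in the third. *)
Lemma additivity_defect_cvg0 phi x y :
  m (fun a => phi (q j (x + y) a - q j x a - q j y a) ^+ 2) @[j --> \oo]
  --> (0 : R).
Proof.
have bd j z := bounded_sqr (bounded_functional_second_difference phi j z).
apply: (@squeeze_cvgr _ _ _ _ (cst 0)
  (fun j => defect phi x j + defect phi y j + defect phi (y - x) j)).
- apply: nearW => j.
  set h := fun a => _.
  have bh : bounded_function h.
    apply: bounded_sqr; under eq_fun do rewrite !operatorB.
    by apply: boundedB; [apply: boundedB|]; exact: bounded_functional_quotient.
  apply/andP; split; first by apply: (mean_ge0 mm) => // a; exact: sqr_ge0.
  pose b a := a + 2 ^- j *: x + 2 ^- j *: x.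
  have bdb : bounded_function (fun a => phi (sd j (y - x) (b a)) ^+ 2).
    exact: (bounded_comp b (bd j (y - x))).
  have -> : defect phi (y - x) j = m (fun a => phi (sd j (y - x) (b a)) ^+ 2).
    rewrite /defect -(minv (2 ^- j *: x + 2 ^- j *: x) (bd j (y - x))); congr m.
    by apply/funext => a; rewrite /b addrA.
  rewrite -!meanD//; last exact: boundedD.
  apply: le_mean => // [|a]; first by apply: boundedD => //; exact: boundedD.
  rewrite /h additivity_defect (functionalZ phi 2^-1) (operatorB phi (_ + _)).
  rewrite (operatorD phi (sd j x a)) -/(b a).
  move: (phi _) (phi _) (phi _) => r s t.
  (* The squares of [r + s - t], [r - s], [r + t] and [s + t] add up to three times the sum of the
     squares of [r], [s] and [t]. *)
  have := sqr_ge0 (r - s); have := sqr_ge0 (r + t); have := sqr_ge0 (s + t).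
  have := sqr_ge0 r; have := sqr_ge0 s; have := sqr_ge0 t.
  rewrite !expr2; nra.
- exact: cvg_cst.
- rewrite -(addr0 0) -{1}(addr0 0).
  by apply: cvgD; [apply: cvgD|]; exact: defect_cvg0.
Qed.

End EnergyIncrement.

(** On pairs [(j, a)] the mean takes the invariant mean in [a] first and the limit in [j] second, so
    every squared additivity defect has mean zero. One ultrafilter then serves all [phi], [x] and
    [y] at once. *)
Lemma asymptotic_additivity : exists W : set_system (nat * E),
  UltraFilter W /\ forall phi x y,
    phi (q p.1 (x + y) p.2 - q p.1 x p.2 - q p.1 y p.2) @[p --> W] --> (0 : R).
Proof.
have [m [mm minv]] := invariant_mean_exists R E.
have [N [UN NN]] := @ultraFilterLemma nat \oo _.
have mN := @ultra_lim_mean R _ N UN.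
have [W [UW hW]] := null_mean_ultra (mean_prod mN mm).
exists W; split => // phi x y.
pose h (p : nat * E) := phi (q p.1 (x + y) p.2 - q p.1 x p.2 - q p.1 y p.2).
have bh : bounded_function (fun p => h p ^+ 2).
  apply: bounded_sqr; rewrite /h; under eq_fun do rewrite !operatorB.
  have bq z : bounded_function (fun p : nat * E => phi (q p.1 z p.2)).
    exists (`|phi| * (c * `|z|)) => p; apply: (le_trans (ler_opnorm _ _)).
    by rewrite ler_wpM2l//; exact: dyadic_quotient_norm.
  by apply: boundedB => //; exact: boundedB.
have h2 : (fun p => h p ^+ 2) @ W --> (0 : R).
  apply: hW => // [p|]; first exact: sqr_ge0.
  apply/cvg_lim => //; apply: cvg_trans (additivity_defect_cvg0 mm minv phi x y).
  exact: cvg_app.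
apply/cvgrPdist_lt => e e0; move/cvgrPdist_lt : h2 => /(_ (e ^+ 2)).
rewrite exprn_gt0// => /(_ isT); apply: filterS => p.
rewrite !sub0r !normrN normrX => hp; rewrite -/(h p).
by rewrite -(ltr_pXn2r (_ : 0 < 2)%N) ?nnegrE// ltW.
Qed.

End Differentiability.

(** * Limits of the quotients under an approximable operator *)

Section LimitDerivative.
Context (R : realType).
Implicit Types E F G X : completeNormedModType R.

Lemma cvg_norm_le (F : normedModType R) (I : Type) (W : set_system I)
    (PW : ProperFilter W) (u : I -> F) (l : F) (c : R) :
  u @ W --> l -> (forall i, `|u i| <= c) -> `|l| <= c.
Proof.
move=> /cvgrPdist_lt ul uc; apply/ler_addgt0Pr => e e0.
have [i hi] := filter_ex (ul e e0).
rewrite -(subrK (u i) l) addrC; apply: (le_trans (ler_normD _ _)).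
by rewrite lerD// ltW.
Qed.

Lemma operator_cvg (E F : normedModType R) (T : operator E F) (I : Type)
    (W : set_system I) (FW : Filter W) (u : I -> E) (l : E) :
  u @ W --> l -> T (u i) @[i --> W] --> T l.
Proof. by move=> ul; apply: continuous_cvg => //; exact: operator_continuous. Qed.

Lemma finite_rank_approximable E F (T : operator E F) :
  finite_rank T -> approximable T.
Proof. by move=> fT; apply/approximableP => e e0; exists T; rewrite ?subrr ?normr0. Qed.

Section Derivative.
Variables (E G : completeNormedModType R) (f : E -> G) (c : R).
Hypotheses (c0 : 0 <= c) (fc : forall x y, `|f x - f y| <= c * `|x - y|).
Variable W : set_system (nat * E).
Context {UW : UltraFilter W}.
Local Notation q := (dyadic_quotient f).
Hypothesis q_add : forall (phi : dual G) x y,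
  phi (q p.1 (x + y) p.2 - q p.1 x p.2 - q p.1 y p.2) @[p --> W] --> (0 : R).

(** The quotients are bounded, so their images under [U] converge in norm; the limit is additive
    because [op_comp phi U] is a functional on [G], to which [q_add] applies. *)
Lemma limit_derivative X (U : operator G X) : approximable U ->
  exists D : operator E X, forall x, U (q p.1 x p.2) @[p --> W] --> D x.
Proof.
move=> aU.
pose D x := lim (U (q p.1 x p.2) @[p --> W]).
have cD x : U (q p.1 x p.2) @[p --> W] --> D x.
  apply: (approximable_ultra_cvg UW (c := c * `|x|) aU) => p.
  exact: dyadic_quotient_norm.
have DD : {morph D : x y / x + y}.
  move=> x y; apply/eqP; rewrite -subr_eq0 opprD addrA; apply/eqP.
  apply: functional_separation => phi.
  have c1 : op_comp phi U (q p.1 (x + y) p.2 - q p.1 x p.2 - q p.1 y p.2)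
      @[p --> W] --> phi (D (x + y) - D x - D y).
    under eq_fun do rewrite !operatorB.
    rewrite !operatorB.
    by apply: cvgB; [apply: cvgB|]; exact: (operator_cvg (T := phi) _ (cD _)).
  exact: (cvg_unique _ c1 (q_add (op_comp phi U) x y)).
have Dc x : `|D x| <= `|U| * c * `|x|.
  apply: (cvg_norm_le _ (cD x)) => p; apply: (le_trans (ler_opnorm _ _)).
  by rewrite -mulrA ler_wpM2l// dyadic_quotient_norm.
have [T TD] := operator_of_additive DD Dc.
by exists T => x; rewrite TD.
Qed.

(** A finite-rank [S] near [U] has a limit derivative of its own, with range in the span of the
    vectors of [S], and at distance at most [|U - S| * c] from [D]. *)
Lemma limit_derivative_approximable X (U : operator G X) (D : operator E X) :
  approximable U -> (forall x, U (q p.1 x p.2) @[p --> W] --> D x) ->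
  approximable D.
Proof.
move=> /approximableP aU cD; apply/approximableP => e e0.
have c1 : 0 < c + 1 by rewrite ltr_wpDl.
have [S fS US] := aU (e / (c + 1)) (divr_gt0 e0 c1).
have [DS cDS] := limit_derivative (finite_rank_approximable fS).
exists DS.
  have [n [phi [v Sv]]] := finite_rankE fS.
  exists n, v => x; exists (fun i => lim (phi i (q p.1 x p.2) @[p --> W])).
  apply: (cvg_unique _ (cDS x)) => //.
  have -> : (fun p : nat * E => S (q p.1 x p.2)) =
      fun p => \sum_(i < n) phi i (q p.1 x p.2) *: v i.
    by apply/funext => p; rewrite Sv rank_sumE.
  apply: cvg_big => [|i _]; first exact: add_continuous.
  apply: cvgZr_tmp; apply: ultra_bounded_cvg.
  exists (`|phi i| * (c * `|x|)) => p; apply: (le_trans (ler_opnorm _ _)).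
  by rewrite ler_wpM2l// dyadic_quotient_norm.
apply: (@le_lt_trans _ _ (`|U - S| * c)).
  apply: opnorm_ler => [|x]; first by rewrite mulr_ge0.
  apply: (cvg_norm_le _ (cvgB (cD x) (cDS x))) => p.
  apply: (le_trans (ler_opnorm (U - S) _)).
  by rewrite -mulrA ler_wpM2l// dyadic_quotient_norm.
apply: (@le_lt_trans _ _ (`|U - S| * (c + 1))).
  by rewrite ler_wpM2l// lerDl.
by rewrite -ltr_pdivlMr.
Qed.

End Derivative.

End LimitDerivative.

(** * Linearizing a Lipschitz family with values in the bidual *)

Section Linearization.
Context (R : realType).
Implicit Types E F G : normedModType R.

(** The integral of a bounded family against a mean, in the weak-star sense; in general it leaves
    [F]. *)
Lemma weak_mean F (I : Type) (m : (I -> R) -> R) (p : I -> F) (c : R) :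
  mean m -> 0 <= c -> (forall i, `|p i| <= c) ->
  exists2 xi : dual (dual F),
    (forall phi : dual F, xi phi = m (fun i => phi (p i))) & `|xi| <= c.
Proof.
move=> mm c0 pc.
have bp (phi : dual F) i : `|phi (p i)| <= c * `|phi|.
  apply: (le_trans (ler_opnorm _ _)); by rewrite mulrC ler_wpM2r.
have [|phi|xi xiE] := @operator_of_bound R (dual F) R
    (fun phi => m (fun i => phi (p i))) c.
- move=> a phi psi; rewrite -(mean_linear mm) //.
  + by exists (c * `|phi|).
  + by exists (c * `|psi|).
- exact: (mean_norm_le mm).
exists xi => //; apply: opnorm_ler => // phi; rewrite xiE.
exact: (mean_norm_le mm).
Qed.

(* Averaging over [G] makes the limit additive; the inner average over the
   translates by the range of [B] keeps its values on that range. *)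
Lemma lipschitz_linearization E F G (B : operator E G) (T : operator E F)
    (I : Type) (W : set_system I) (UW : UltraFilter W) (f : I -> G -> F)
    (c : R) : 0 <= c ->
  (forall i x y, `|f i x - f i y| <= c * `|x - y|) ->
  (forall x, f i (B x) @[i --> W] --> T x) ->
  exists m : (G * (E * I) -> R) -> R, mean m /\
  exists L : operator G (dual (dual F)),
    (forall x phi, L x phi = m (fun k =>
       phi (f k.2.2 (x + k.1 + B k.2.1) - f k.2.2 (k.1 + B k.2.1)))) /\
    (forall x, L (B x) = canonical_inclusion F (T x)).
Proof.
move=> c0 fc fT.
have [mG [mmG invG]] := invariant_mean_exists R G.
have [mE [mmE invE]] := invariant_mean_exists R E.
have mW := @ultra_lim_mean R _ W UW.
have mEW := mean_prod mmE mW.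
have mm := mean_prod mmG mEW.
set m := (X in mean X) in mm.
exists m; split => //.
pose d x (k : G * (E * I)) := f k.2.2 (x + k.1 + B k.2.1) - f k.2.2 (k.1 + B k.2.1).
have dc x k : `|d x k| <= c * `|x|.
  by apply: (le_trans (fc _ _ _)); rewrite opprD addrACA subrr addr0 addrK.
have bd (phi : dual F) x k : `|phi (d x k)| <= c * `|x| * `|phi|.
  by apply: (le_trans (ler_opnorm _ _)); rewrite mulrC ler_wpM2r.
have ex x : { xi : dual (dual F) |
    (forall phi : dual F, xi phi = m (fun k => phi (d x k))) /\
    `|xi| <= c * `|x| }.
  apply: cid; have [xi h1 h2] := weak_mean mm (mulr_ge0 c0 (normr_ge0 x)) (dc x).
  by exists xi.
pose L x := sval (ex x).
have LE x phi : L x phi = m (fun k => phi (d x k)) by exact: (svalP (ex x)).1.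
have Lc x : `|L x| <= c * `|x| by exact: (svalP (ex x)).2.
pose h (phi : dual F) x u := mE (fun e => lim (phi (d x (u, (e, i))) @[i --> W])).
have mh (phi : dual F) x : m (fun k => phi (d x k)) = mG (h phi x) by [].
have bh (phi : dual F) x : bounded_function (h phi x).
  exists (c * `|x| * `|phi|) => u.
  exact: (mean_norm_le mEW (h := fun k : E * I => phi (d x (u, k)))).
have LD : {morph L : x y / x + y}.
  move=> x y; apply: operatorP => phi.
  (* The increment along [x + y] at [u] is the one along [x] at [u + y] plus the one along [y] at
     [u]; invariance of [mG] absorbs the shift. *)
  rewrite -[RHS]/(L x phi + L y phi) !LE !mh -(invG _ y (bh phi x)).
  rewrite -(meanD mmG (bounded_comp (fun u => u + y) (bh phi x)) (bh phi y)).
  congr mG; apply/funext => u.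
  have bdk z v : bounded_function (fun k : E * I => phi (d z (v, k))).
    by exists (c * `|z| * `|phi|) => k; exact: bd.
  rewrite /h -(meanD mEW (bdk x (u + y)) (bdk y u)).
  congr mE; apply/funext => e /=; congr (lim (_ @ W)); apply/funext => i /=.
  rewrite -operatorD; congr (phi _); rewrite /d/=.
  by rewrite (addrC u y) !addrA subrK.
have [L' L'E] := operator_of_additive LD Lc.
exists L'; split => [x phi|x]; first by rewrite L'E LE.
rewrite L'E; apply: operatorP => phi.
rewrite LE mh -[RHS]/(phi (T x)) -[RHS](mean_cst mmG); congr mG.
apply/funext => u; rewrite /h.
(* Subtracting [f i (B e)] keeps [g] bounded. The increment along [B x] is [g (e + x) i - g e i]
   plus an increment of [f i] along the range of [B], which tends to [phi (T x)]; the invariant mean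
   over [e] cancels the first two terms. *)
pose g e i := phi (f i (u + B e) - f i (B e)).
have bg : bounded_function (fun k : E * I => g k.1 k.2).
  exists (`|phi| * (c * `|u|)) => -[e i]; apply: (le_trans (ler_opnorm _ _)).
  by rewrite ler_wpM2l//; apply: (le_trans (fc _ _ _)); rewrite addrK.
have bge e : bounded_function (g e).
  exact: (bounded_comp (fun i => (e, i)) bg).
pose k e := lim (g e @ W).
have bk : bounded_function k by exact: (bounded_mean mW).
have -> : (fun e => lim (phi (d (B x) (u, (e, i))) @[i --> W])) =
    fun e => k (e + x) - k e + phi (T x).
  apply/funext => e; apply/cvg_lim => //.
  have -> : (fun i => phi (d (B x) (u, (e, i)))) =
      fun i => g (e + x) i - g e i + phi (f i (B (e + x)) - f i (B e)).
    apply/funext => i; rewrite /g /d/= !operatorB operatorD.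
    rewrite (addrC (B x) u) -addrA (addrC (B x)); ring.
  apply: cvgD; first by apply: cvgB; exact: ultra_bounded_cvg.
  apply: operator_cvg; rewrite -[T x](addrK (T e)) -operatorD addrC (addrC x).
  by rewrite addrC; apply: cvgB.
have bkx := bounded_comp (fun e => e + x) bk.
rewrite (meanD mmE (boundedB bkx bk) (bounded_cst _ _)) (meanB mmE bkx bk).
by rewrite invE// subrr add0r (mean_cst mmE).
Qed.

End Linearization.

(** * Helly's lemma in the bidual *)

Section Helly.
Context (R : realType).
Implicit Types E F G : normedModType R.

(* A near-minimizer [x0] of the sum of squares over the ball of radius [|chi|]
   nearly minimizes the functional [\sum (phi x0 - chi phi) phi] there, which
   bounds the sum of squares at [x0]. *)
Lemma helly E (chi : dual (dual E)) (s : seq (dual E)) (e : R) : 0 < e ->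
  exists2 x : E, `|x| <= `|chi| & {in s, forall phi : dual E, `|phi x - chi phi| <= e}.
Proof.
move=> e0.
have [chi0|chi0] := eqVneq chi 0.
  exists 0; first by rewrite normr0.
  by move=> phi _; rewrite chi0 operator0 sub0r normrN normr0 ltW.
have c0 : 0 < `|chi| by rewrite normr_gt0.
set c := `|chi| in c0 *.
pose u x (phi : dual E) : R := phi x - chi phi.
pose Q x : R := \sum_(phi <- s) u x phi ^+ 2.
pose ev x (phi : dual E) : R := phi x.
have Q0 x : 0 <= Q x by apply: sumr_ge0 => phi _; exact: sqr_ge0.
(* [M] bounds the sum of the squares of [phi w] for [w] a difference of two points of the ball. With
   slack [t ^+ 2] at [x0] and a step [t] towards [x], the second-order errors add up to at most
   [t ^+ 2 * (1 + M) <= t * e ^+ 2]. *)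
pose M : R := \sum_(phi <- s) (`|phi| * (2 * c)) ^+ 2.
have M0 : 0 <= M by apply: sumr_ge0 => phi _; exact: sqr_ge0.
pose eta := e ^+ 2 / (1 + M).
have M1 : 0 < 1 + M by rewrite ltr_wpDr.
have eta0 : 0 < eta by rewrite divr_gt0// exprn_gt0.
suff [x xc Qx] : exists2 x, `|x| <= c & Q x <= e ^+ 2.
  exists x => // phi phis; rewrite -(@ler_pXn2r _ 2) ?nnegrE ?(ltW e0)//.
  rewrite real_normK ?num_real//; apply: le_trans Qx.
  by rewrite /Q (big_rem phi)//= lerDl sumr_ge0// => psi _; exact: sqr_ge0.
pose t := Num.min eta 1.
have t0 : 0 < t by rewrite lt_min eta0 ltr01.
have t1 : t <= 1 by rewrite ge_min lexx orbT.
have te : t <= eta by rewrite ge_min lexx.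
pose A := [set Q x | x in [set x | `|x| <= c]].
have infA : has_inf A.
  split; first by exists (Q 0), 0 => //=; rewrite normr0 ltW.
  by exists 0 => _ [x _ <-].
have [_ [x0 /= x0c <-] Qx0] := inf_adherent (exprn_gt0 2 t0) infA.
have Qinf x : `|x| <= c -> inf A <= Q x.
  by move=> xc; apply: ge_inf; [exact: infA.2|exists x].
exists x0 => //.
pose psi : dual E := \sum_(phi <- s) u x0 phi *: phi.
have psiE x : psi x = \sum_(phi <- s) u x0 phi * ev x phi.
  by rewrite /psi sum_operatorE.
have psi_ge x : `|x| <= c -> psi x0 - e ^+ 2 <= psi x.
  move=> xc; pose w := x - x0.
  have : `|x0 + t *: w| <= c.
    have -> : x0 + t *: w = (1 - t) *: x0 + t *: x.
      by rewrite /w scalerBr scalerBl scale1r addrCA addrC.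
    apply: (le_trans (ler_normD _ _)); rewrite !normrZ ger0_norm ?subr_ge0//.
    rewrite gtr0_norm//; have := ler_wpM2l (ltW t0) xc.
    have : (1 - t) * `|x0| <= (1 - t) * c by rewrite ler_wpM2l// subr_ge0.
    lra.
  move=> /Qinf.
  have -> : Q (x0 + t *: w) =
      Q x0 + 2 * t * (psi x - psi x0) + t ^+ 2 * \sum_(phi <- s) ev w phi ^+ 2.
    rewrite -operatorB -/w psiE /Q 2!mulr_sumr -!big_split/=.
    apply: eq_bigr => phi _; rewrite /u /ev operatorD functionalZ; ring.
  have wM : \sum_(phi <- s) ev w phi ^+ 2 <= M.
    apply: ler_sum => phi _; rewrite -real_normK ?num_real//.
    rewrite lerXn2r ?nnegrE ?mulr_ge0 ?(ltW c0)//.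
    apply: (le_trans (ler_opnorm phi w)); rewrite ler_wpM2l//.
    apply: (le_trans (ler_normB _ _)); rewrite mulr_natl mulr2n lerD//.
  have := ler_wpM2l (sqr_ge0 t) wM.
  move: Qx0; move: (Q x0) (inf A) (\sum_(phi <- s) _) => q i v.
  move: (psi x) (psi x0) => p p0 h1 h2 h3.
  have h4 : 0 <= t * (2 * (p - p0) + t * (1 + M)).
    have -> : t * (2 * (p - p0) + t * (1 + M)) =
      2 * t * (p - p0) + t ^+ 2 + t ^+ 2 * M by ring.
    lra.
  have h5 : t * (1 + M) <= e ^+ 2 by rewrite -ler_pdivlMr.
  have := e0; rewrite -(pmulr_rge0 _ t0) in h4 * => _; nra.
(* Evaluating [psi_ge] at the multiples of [- x] of norm [c] bounds [psi]. As [|chi| = c], this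
   gives [- chi psi <= e ^+ 2 - psi x0], while [Q x0 = psi x0 - chi psi]. *)
have npsi : `|psi| <= (e ^+ 2 - psi x0) / c.
  have h x : x != 0 -> psi x * c <= (e ^+ 2 - psi x0) * `|x|.
    move=> xn0; have nx : 0 < `|x| by rewrite normr_gt0.
    have := psi_ge (- (c / `|x|) *: x).
    rewrite normrZ normrN gtr0_norm ?divr_gt0// divfK ?gt_eqF// => /(_ (lexx _)).
    rewrite functionalZ mulNr lerNr opprB mulrAC -ler_pdivlMr ?invr_gt0//.
    by rewrite invrK mulrC.
  have pos : 0 <= e ^+ 2 - psi x0.
    have := psi_ge 0; rewrite normr0 operator0 => /(_ (ltW c0)); lra.
  apply: opnorm_ler => [|x]; first by rewrite divr_ge0// ltW.
  have [->|xn0] := eqVneq x 0; first by rewrite operator0 !normr0 mulr0.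
  rewrite mulrAC ler_pdivlMr//.
  have : `|psi x * c| <= (e ^+ 2 - psi x0) * `|x|.
    rewrite ler_norml; apply/andP; split; last exact: h.
    by rewrite lerNl -mulNr -(operatorN psi x) -(normrN x); apply: h; rewrite oppr_eq0.
  by rewrite normrM (gtr0_norm c0).
have : - (e ^+ 2 - psi x0) <= chi psi.
  have := ler_opnorm chi psi; rewrite ler_norml => /andP[+ _].
  apply: le_trans; rewrite lerN2 -/c mulrC -ler_pdivlMr//.
have -> : chi psi = \sum_(phi <- s) u x0 phi * chi phi.
  rewrite /psi operator_sum; apply: eq_bigr => phi _; exact: functionalZ.
have -> : Q x0 = psi x0 - \sum_(phi <- s) u x0 phi * chi phi.
  by rewrite psiE -sumrB; apply: eq_bigr => phi _; rewrite -mulrBr expr2.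
lra.
Qed.

End Helly.

(** * Operators into the bidual and Gantmacher's theorem *)

Section Bidual.
Context (R : realType).

Lemma canonical_inclusion_norm (F : normedModType R) (y : F) :
  `|canonical_inclusion F y| = `|y|.
Proof.
apply/eqP; rewrite eq_le; apply/andP; split.
  by apply: opnorm_ler => // phi; rewrite mulrC; exact: (ler_opnorm phi y).
apply: norm_le_functional => phi phi1.
apply: (le_trans (ler_opnorm (canonical_inclusion F y) phi)).
by rewrite ler_piMr.
Qed.

Lemma bidual_range_operator (G F : normedModType R)
    (L : operator G (dual (dual F))) :
  (forall x, exists y, L x = canonical_inclusion F y) ->
  exists K : operator G F, forall x, L x = canonical_inclusion F (K x).
Proof.
move=> /choice[k Lk].
have [a x y|x|K Kk] := @operator_of_bound R G F k `|L|.
- apply: functional_ext => phi.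
  have e z : phi (k z) = L z phi by rewrite Lk.
  by rewrite operatorD functionalZ !e operatorD operatorZ.
- by rewrite -canonical_inclusion_norm -Lk; exact: ler_opnorm.
by exists K => x; rewrite Lk Kk.
Qed.

Implicit Types F G : completeNormedModType R.

Lemma weak_continuous F (phi : dual F) :
  continuous (fun v : weak_space F => phi v).
Proof.
move=> v.
pose ev := (fun x phi => phi x) : F -> {ptws dual F -> R}.
have c1 : {for v, continuous (ev : weak_space F -> {ptws dual F -> R})}.
  exact: (@initial_continuous _ _ ev).
have c2 : continuous (fun g : {ptws dual F -> R} => g phi).
  exact: (@proj_continuous (dual F) (fun=> R) phi).
exact: (continuous_comp c1 (c2 _)).
Qed.

(** By [helly], points [x] of the unit ball nearly represent [z] on any finite set of functionals
    [op_comp phi S]. Their images [S x] lie in a weakly compact set, and a cluster point of them is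
    [y]. *)
Lemma weakly_compact_bidual G F (S : operator G F) (z : dual (dual G)) :
  weakly_compact S ->
  exists y : F, forall phi : dual F, z (op_comp phi S) = phi y.
Proof.
move=> [K SK [cK _]].
wlog z1 : z / `|z| <= 1.
  move=> hz; have r0 : 0 < `|z| + 1 by rewrite ltr_wpDl.
  have [|y hy] := hz ((`|z| + 1)^-1 *: z).
    rewrite normrZ normfV gtr0_norm// ler_pdivrMl// mulr1 lerDl//.
  exists ((`|z| + 1) *: y) => phi; rewrite functionalZ -hy.
  by rewrite -[X in _ * X]/((`|z| + 1)^-1 * z (op_comp phi S)) mulVKf// gt_eqF.
pose D := [set p : seq (dual F) * R | 0 < p.2].
pose A (p : seq (dual F) * R) := [set S x | x in [set x | `|x| <= 1 /\
  {in p.1, forall phi : dual F, `|phi (S x) - z (op_comp phi S)| <= p.2}]].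
have PF : ProperFilter (filter_from D A).
  apply: filter_from_proper.
    apply: filter_from_filter; first by exists ([::], 1); exact: ltr01.
    move=> [s d] [s' d'] /= d0 d'0; exists (s ++ s', Num.min d d') => /=.
      by rewrite /D/= lt_min d0.
    move=> _ [x [x1 xs] <-]; split; exists x => //; split => // phi /= phis.
      have := xs phi; rewrite mem_cat phis => /(_ isT) /le_trans; apply.
      by rewrite ge_min lexx.
    have := xs phi; rewrite mem_cat phis orbT => /(_ isT) /le_trans; apply.
    by rewrite ge_min lexx orbT.
  move=> [s d] /= d0.
  have [x x1 xs] := helly z [seq op_comp phi S | phi <- s] d0.
  exists (S x), x => //; split; first exact: le_trans z1.
  by move=> phi phis; exact: (xs (op_comp phi S) (map_f _ phis)).
have FK : filter_from D A K.
  by exists ([::], 1) => [|_ [x [x1 _] <-]]; [exact: ltr01|apply: SK; exists x].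
have [y [_ cy]] := cK _ PF FK.
exists y => phi; apply/eqP; rewrite -subr_eq0 -normr_le0.
apply/ler_addgt0Pl => e e0; rewrite addr0.
have e2 : 0 < e / 2 by rewrite divr_gt0.
have FA : filter_from D A (A ([:: phi], e / 2)) by exists ([:: phi], e / 2).
have [_ [[x [_ xs] <-] yx]] := cy _ _ FA
  (weak_continuous (nbhsx_ballx (phi y) _ e2)).
rewrite (splitr e) -(subrKA (phi (S x))); apply: (le_trans (ler_normD _ _)).
apply: lerD; last by apply/ltW; rewrite distrC; rewrite -ball_normE in yx.
by rewrite distrC; apply: xs; exact: mem_head.
Qed.

End Bidual.

(** * From a Lipschitz factorization to a linear one through the bidual *)

Section LipschitzFactorization.
Context (R : realType).
Implicit Types E F G X : completeNormedModType R.

Lemma lipschitz_factor_bidual E F G1 G2 X1 X2 (T : operator E F)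
    (f1 : E -> G1) (f2 : G2 -> F) (S0 : operator G1 G2)
    (V : operator X2 G2) (S : operator X1 X2) (U : operator G1 X1) :
  Lip0 f1 -> Lip0 f2 -> (T : E -> F) = f2 \o S0 \o f1 ->
  S0 = op_comp V (op_comp S U) -> approximable U ->
  exists (D : operator E X1) (L : operator G2 (dual (dual F))),
    [/\ approximable D,
        forall x, L (V (S (D x))) = canonical_inclusion F (T x) &
        weakly_compact_Lip0 f2 ->
          forall x, exists y, L x = canonical_inclusion F y].
Proof.
move=> [_ /lipschitz_bound[c1 c10 fc1]] [_ /lipschitz_bound[c2 c20 fc2]] TE S0E aU.
have [W [UW qW]] := asymptotic_additivity fc1.
have [D cD] := limit_derivative fc1 qW aU.
have aD : approximable D := limit_derivative_approximable c10 fc1 qW aU cD.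
pose B := op_comp V (op_comp S D).
pose f (i : nat * E) y := dyadic_quotient f2 i.1 y (S0 (f1 i.2)).
(* An exact chain rule: the quotients of the linear [T] are constant, and they are those of [f2] at
   [S0 (f1 a)] applied to [S0] of those of [f1]. *)
have f_T i x : f i (S0 (dyadic_quotient f1 i.1 x i.2)) = T x.
  rewrite /f /dyadic_quotient operatorZ scalerA mulVf ?gt_eqF ?expr2_gt0//.
  rewrite scale1r operatorB (addrC (S0 (f1 i.2))) subrK.
  have Tf a : f2 (S0 (f1 a)) = T a by rewrite TE.
  rewrite !Tf operatorD operatorZ addrAC subrr add0r scalerA.
  by rewrite mulfV ?gt_eqF ?expr2_gt0// scale1r.
(* The arguments in [f_T] converge to [B x], and the maps [f i] share a Lipschitz constant. *)
have fT x : f i (B x) @[i --> W] --> T x.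
  have cB : op_comp V S (U (dyadic_quotient f1 i.1 x i.2)) @[i --> W]
      --> op_comp V S (D x).
    exact: (operator_cvg (T := op_comp V S) _ (cD x)).
  apply/cvgrPdist_le => e e0.
  have c21 : 0 < c2 + 1 by rewrite ltr_wpDl.
  move/cvgrPdist_le : cB => /(_ (e / (c2 + 1)) (divr_gt0 e0 c21)).
  apply: filterS => i hi; rewrite -(f_T i x).
  apply: (le_trans (dyadic_quotient_lipschitz _ _ _ _ fc2)); rewrite distrC S0E.
  apply: (@le_trans _ _ ((c2 + 1) * (e / (c2 + 1)))).
    by rewrite ler_pM// lerDl.
  by rewrite mulrC divfK// gt_eqF.
have [m [mm [L [LE LB]]]] := lipschitz_linearization UW c20
  (fun i x y => dyadic_quotient_lipschitz i.1 (S0 (f1 i.2)) x y fc2) fT.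
exists D, L; split; [exact: aD|exact: LB|].
(* Here [f2 = S2 o g], so [L x] is the image under the second adjoint of [S2] of the weak-star mean
   [z] of increments of [g]. *)
move=> [G [g [S2 [[_ /lipschitz_bound[c3 c30 gc]] wS2 f2E]]]] x.
pose p (k : G2 * (E * (nat * E))) :=
  dyadic_quotient g k.2.2.1 (x + k.1 + B k.2.1) (S0 (f1 k.2.2.2)) -
  dyadic_quotient g k.2.2.1 (k.1 + B k.2.1) (S0 (f1 k.2.2.2)).
have [|z zE _] := weak_mean (p := p) mm (mulr_ge0 c30 (normr_ge0 x)).
  move=> k; apply: (le_trans (dyadic_quotient_lipschitz _ _ _ _ gc)).
  by rewrite opprD addrACA subrr addr0 addrK.
have [y yE] := weakly_compact_bidual z wS2.
exists y; apply: operatorP => phi; rewrite LE -[RHS]/(phi y) -yE zE.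
congr m; apply/funext => k; congr (phi _).
by rewrite /f /dyadic_quotient f2E /p operatorB !operatorZ !operatorB.
Qed.

End LipschitzFactorization.

(** * Local reflexivity for finite linear systems *)

Section LocalReflexivity.
Context (R : realType) (F : normedModType R) (I K : finType).
Variables (a : K -> I -> R) (b : K -> F) (r : K -> R).
Variable chi : I -> dual (dual F).
Hypothesis r_gt0 : forall k, 0 < r k.
Hypothesis chi_sol :
  forall k, `|canonical_inclusion F (b k) - \sum_i a k i *: chi i| <= r k.

Let combine (w : I -> F) k := \sum_i a k i *: w i.

(** The infimum [p y] is the distance from [y] to the range of [combine] in the sup norm with
    weights [1 / r k]. The clause [0 <= c] keeps the set bounded below even when [K] is empty. *)
Let within c (y : K -> F) := 0 <= c /\
  exists w, forall k, `|y k - combine w k| <= c * r k.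

Let p (y : K -> F) := inf [set c | within c y].

Let combine0 k : combine (fun=> 0) k = 0.
Proof. by rewrite /combine big1// => i _; rewrite scaler0. Qed.

Let combineD v w k : combine (fun i => v i + w i) k = combine v k + combine w k.
Proof. by rewrite /combine -big_split; apply: eq_bigr => i _; rewrite scalerDr. Qed.

Let combineZ c w k : combine (fun i => c *: w i) k = c *: combine w k.
Proof.
by rewrite /combine scaler_sumr; apply: eq_bigr => i _; rewrite !scalerA mulrC.
Qed.

Let within_inf y : has_inf [set c | within c y].
Proof.
split; last by exists 0 => c [].
have s0 k : 0 <= `|y k| / r k by rewrite divr_ge0// ltW.
exists (\sum_k `|y k| / r k); split; first by apply: sumr_ge0.
exists (fun=> 0) => k; rewrite combine0 subr0 -ler_pdivrMr// (bigD1 k)//=.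
by rewrite lerDl sumr_ge0.
Qed.

Let p_le c y : within c y -> p y <= c.
Proof. by move=> h; apply: ge_inf; [exact: (within_inf y).2|]. Qed.

Let le_p c y : (forall d, within d y -> c <= d) -> c <= p y.
Proof. by move=> h; apply: lb_le_inf; [exact: (within_inf y).1|]. Qed.

Let sublinear_p : sublinear (p : (K -> F) -> R).
Proof.
split=> [x y|c x c0].
  rewrite -lerBlDl; apply: le_p => d [d0 [v hv]].
  rewrite lerBlDl -lerBlDr; apply: le_p => e [e0 [w hw]]; rewrite lerBlDr.
  apply: p_le; split; first exact: addr_ge0.
  exists (fun i => w i + v i) => k; rewrite combineD mulrDl.
  have -> : (x + y) k - (combine w k + combine v k) =
      (x k - combine w k) + (y k - combine v k).
    by rewrite opprD addrACA.
  by apply: (le_trans (ler_normD _ _)); rewrite lerD.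
rewrite mulrC -ler_pdivrMr//; apply: le_p => d [d0 [w hw]].
rewrite ler_pdivrMr// mulrC; apply: p_le; split; first by rewrite mulr_ge0// ltW.
exists (fun i => c *: w i) => k; rewrite combineZ -[(c *: x) k]/(c *: x k).
by rewrite -scalerBr normrZ gtr0_norm// -mulrA ler_pM2l.
Qed.

(* If the system had no approximate solution in [F], a functional vanishing on
   the range of the system would separate it from [b]; that functional is
   contradicted by the bidual solution through [helly]. *)
Lemma bidual_system (e : R) : 0 < e ->
  exists w : I -> F, forall k, `|b k - \sum_i a k i *: w i| <= (1 + e) * r k.
Proof.
move=> e0.
suff pb : p b <= 1.
  have [c [c0 [w hw]] ce] := inf_adherent e0 (within_inf b).
  exists w => k; apply: (le_trans (hw k)); rewrite ler_wpM2r ?(ltW (r_gt0 k))//.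
  by apply: (le_trans (ltW ce)); rewrite lerD2r.
have [l [lin lp lb]] := hahn_banach b sublinear_p.
have lD x y : l (x + y) = l x + l y.
  by have := lin 1 x y; rewrite scale1r mul1r.
have l0 : l 0 = 0.
  by apply: (addrI (l 0)); rewrite -lD !addr0.
have lZ c x : l (c *: x) = c * l x.
  by have := lin c x 0; rewrite !addr0 l0 addr0.
pose delta k (v : F) : K -> F := fun j => if j == k then v else 0.
have deltaP k c x y : delta k (c *: x + y) = c *: delta k x + delta k y.
  apply/funext => j; rewrite -[RHS]/(c *: delta k x j + delta k y j) /delta.
  by case: eqP => // _; rewrite scaler0 addr0.
have lN x : l (- x) = - l x by rewrite -scaleN1r lZ mulN1r.
have within_delta k v : within ((r k)^-1 * `|v|) (delta k v).
  have c0 : 0 <= (r k)^-1 * `|v| by rewrite mulr_ge0// invr_ge0 ltW.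
  split => //; exists (fun=> 0) => j; rewrite combine0 subr0 /delta.
  case: eqP => [->|_]; first by rewrite mulrAC mulVf ?mul1r// gt_eqF.
  by rewrite normr0 mulr_ge0// ltW.
have deltaN k v : - delta k v = delta k (- v).
  by apply/funext => j; rewrite -[LHS]/(- delta k v j) /delta; case: eqP => // _; rewrite oppr0.
have [alpha alphaE] : exists alpha : K -> dual F,
    forall k v, alpha k v = l (delta k v).
  suff /choice[alpha alphaE] : forall k, exists alpha : dual F,
      forall v, alpha v = l (delta k v) by exists alpha.
  move=> k.
  have [c x y|v|al alE] :=
      @operator_of_bound R F R (fun v => l (delta k v)) (r k)^-1.
  - by rewrite deltaP lin.
  - rewrite ler_norml lerNl -lN deltaN -(normrN v); apply/andP; split.
      exact: le_trans (lp _) (p_le (within_delta _ _)).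
    by rewrite normrN; exact: le_trans (lp _) (p_le (within_delta _ _)).
  - by exists al.
have lE y : l y = \sum_k alpha k (y k).
  have -> : y = \sum_k delta k (y k).
    apply/funext => j; rewrite fct_sumE (bigD1 j)//= big1 ?addr0 /delta ?eqxx//.
    by move=> k /negPf; rewrite eq_sym => ->.
  rewrite (big_morph l lD l0); apply: eq_bigr => k _.
  rewrite alphaE fct_sumE (bigD1 k)//= big1 ?addr0 /delta ?eqxx//.
  by move=> j /negPf; rewrite eq_sym => ->.
(* [p] vanishes on the range of [combine], a subspace, and so does [l]; this is tested on families
   supported at [i]. *)
have ann i : \sum_k a k i *: alpha k = 0.
  apply: operatorP => v; rewrite sum_operatorE -[RHS]/(0 : R).
  pose w j := if j == i then v else 0.
  have lw (s : R) : l (combine (fun j => s *: w j)) <= 0.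
    apply: (le_trans (lp _)); apply: p_le; split => //.
    by exists (fun j => s *: w j) => k; rewrite subrr normr0 mul0r.
  have lwZ s : l (combine (fun j => s *: w j)) = s * l (combine w).
    by rewrite -lZ; congr l; apply/funext => k; exact: combineZ.
  have := lw 1; have := lw (- 1); rewrite !lwZ => h1 h2.
  have -> : \sum_k (a k i *: alpha k) v = l (combine w).
    rewrite lE; apply: eq_bigr => k _.
    rewrite /combine (bigD1 i)//= big1 ?addr0 /w ?eqxx; first exact/esym/functionalZ.
    by move=> j /negPf ->; rewrite scaler0.
  apply/eqP; rewrite eq_le; lra.
rewrite -lb; apply/ler_addgt0Pr => d d0.
(* By [ann] the [chi] terms drop out, so [l b] is the sum of the [omega k (alpha k)]. [helly]
   replaces each [omega k] by a vector of norm at most [r k]; at the family of these vectors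
   [l <= p <= 1], and the total error is at most [d]. *)
pose omega k := canonical_inclusion F (b k) - \sum_i a k i *: chi i.
have K1 : 0 < (#|K|.+1%:R : R) by [].
have d' : 0 < d / #|K|.+1%:R by rewrite divr_gt0.
have /choice[x hx] : forall k, exists x : F, `|x| <= r k /\
    `|alpha k x - omega k (alpha k)| <= d / #|K|.+1%:R.
  move=> k; have [x x1 x2] := helly (omega k) [:: alpha k] d'.
  exists x; split; first exact: le_trans (chi_sol k).
  by apply: x2; exact: mem_head.
have -> : l b = \sum_k omega k (alpha k).
  have -> : \sum_k omega k (alpha k) =
      \sum_k (alpha k (b k) - \sum_i a k i * chi i (alpha k)).
    apply: eq_bigr => k _.
    rewrite -[LHS]/(alpha k (b k) - (\sum_i a k i *: chi i) (alpha k)).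
    by rewrite sum_operatorE.
  rewrite sumrB -lE exchange_big/= big1 ?subr0// => i _.
  transitivity (chi i (\sum_k a k i *: alpha k)); last by rewrite ann operator0.
  by rewrite operator_sum; apply: eq_bigr => k _; rewrite functionalZ.
have lx : \sum_k alpha k (x k) <= 1.
  rewrite -lE; apply: (le_trans (lp _)); apply: p_le; split => //.
  by exists (fun=> 0) => k; rewrite combine0 subr0 mul1r; exact: (hx k).1.
have : \sum_k omega k (alpha k) <= \sum_k (alpha k (x k) + d / #|K|.+1%:R).
  by apply: ler_sum => k _; rewrite -lerBlDl; have := (hx k).2;
    rewrite distrC => /(le_trans (ler_norm _)).
move=> /le_trans; apply; rewrite big_split/=; apply: lerD => //.
rewrite sumr_const -mulrnAl -mulr_natr -mulrA ler_piMr ?(ltW d0)//.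
by rewrite ler_pdivrMr// mul1r ler_nat.
Qed.

End LocalReflexivity.

(** * Finite nets of the unit ball for finitely many functionals *)

Section Nets.
Context (R : realType) (X : normedModType R).

(** The values of the [eta i] on the ball are bounded, so they fall into finitely many cells of side
    [d]. Each cell that is met contributes one of its points, every other cell the point [0]. *)
Lemma functional_net n (eta : 'I_n -> dual X) (d : R) : 0 < d ->
  exists (K : finType) (x : K -> X), (forall k, `|x k| <= 1) /\
    forall y, `|y| <= 1 -> exists k, forall i, `|eta i y - eta i (x k)| <= d.
Proof.
move=> d0; pose M := \sum_i `|eta i|.
have etaM i y : `|y| <= 1 -> `|eta i y| <= M.
  move=> y1; apply: (le_trans (ler_opnorm _ _)).
  apply: (@le_trans _ _ `|eta i|); first by rewrite ler_piMr.
  by rewrite /M (bigD1 i)//= lerDl sumr_ge0.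
pose cell y i := Num.truncn ((eta i y + M) / d).
pose P := Num.truncn ((M + M) / d).
have cell_lt y i : `|y| <= 1 -> (cell y i < P.+1)%N.
  move=> y1; rewrite ltnS; apply: le_truncn.
  rewrite ler_wpM2r ?invr_ge0 ?(ltW d0)// lerD2r.
  by apply: (le_trans (ler_norm _)); exact: etaM.
pose K := {ffun 'I_n -> 'I_P.+1}.
have /choice[x hx] : forall k : K, exists x, `|x| <= 1 /\
    ((exists2 y, `|y| <= 1 & forall i, cell y i = k i :> nat) ->
     forall i, cell x i = k i :> nat).
  move=> k; have [[y y1 yk]|h] :=
    pselect (exists2 y, `|y| <= 1 & forall i, cell y i = k i :> nat).
    by exists y.
  by exists 0; rewrite normr0.
exists K, x; split=> [k|y y1]; first exact: (hx k).1.
pose k : K := [ffun i => inord (cell y i)].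
have yk i : cell y i = k i :> nat by rewrite ffunE inordK// cell_lt.
have xk := (hx k).2 (ex_intro2 _ _ y y1 yk).
exists k => i.
have itv z : `|z| <= 1 ->
    (cell z i)%:R <= (eta i z + M) / d < (cell z i).+1%:R.
  move=> z1; apply: truncn_itv; rewrite divr_ge0 ?(ltW d0)//.
  by have := etaM i z z1; rewrite ler_norml => /andP[]; rewrite -lerBlDr sub0r.
have /andP[y2 y3] := itv y y1; have /andP[x2 x3] := itv (x k) (hx k).1.
rewrite xk -yk in x2 x3.
rewrite ler_pdivlMr// in y2; rewrite ltr_pdivrMr// in y3.
rewrite ler_pdivlMr// in x2; rewrite ltr_pdivrMr// in x3.
rewrite -natr1 in y3 x3; rewrite ler_norml; apply/andP; split; lra.
Qed.

End Nets.

(** * Schauder's theorem, the approximation property of the dual, and dual spaces *)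

Section ApproximationProperty.
Context (R : realType).
Implicit Types E F G X : completeNormedModType R.

Lemma opnorm_comp (E F G : normedModType R) (S : operator F G) (T : operator E F) :
  `|op_comp S T| <= `|S| * `|T|.
Proof.
apply: opnorm_ler => [|x]; first exact: mulr_ge0.
by apply: (le_trans (ler_opnorm S (T x))); rewrite -mulrA ler_wpM2l// ler_opnorm.
Qed.

(** Schauder's theorem for the adjoint: the chosen functionals [g phi] have a weak-star limit [xi],
    and a finite-rank operator near [D] turns this into norm convergence after composition with
    [D]. *)
Lemma compact_adjoint_ball E X (D : operator E X) : approximable D ->
  compact [set (op_comp xi D : dual E) | xi in unit_ball (dual X)].
Proof.
move=> /approximableP aD; rewrite compact_ultra => W UW WK.
set K := (X in W X) in WK.
have /choice[g hg] : forall phi : dual E, exists xi : dual X, `|xi| <= 1 /\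
    (K phi -> op_comp xi D = phi).
  move=> phi; have [[xi xi1 <-]|nK] := pselect (K phi); first by exists xi.
  by exists 0; rewrite normr0.
(* [z] lies in the third dual of [X]; restricted to [X] along the canonical inclusion it is the
   weak-star limit. *)
have [z zE z1] := weak_mean (@ultra_lim_mean R _ W UW) ler01 (fun phi => (hg phi).1).
pose xi : dual X := op_comp z (canonical_inclusion X).
have xi1 : `|xi| <= 1.
  apply: opnorm_ler => // x; apply: (le_trans (ler_opnorm z _)).
  by rewrite canonical_inclusion_norm ler_wpM2r.
have xi_lim v : g phi v @[phi --> W] --> xi v.
  rewrite -[xi v]/(z (canonical_inclusion X v)) zE.
  apply: (ultra_bounded_cvg (h := fun phi => g phi v)).
  exists `|v| => phi; apply: (le_trans (ler_opnorm _ _)).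
  by rewrite ler_piMl// (hg phi).1.
exists (op_comp xi D); split; first by exists xi.
apply/cvgrPdist_lt => e e0.
have e4 : 0 < e / 4 by rewrite divr_gt0.
have [S /finite_rankE[n [phi [v ->]]] DS] := aD _ e4.
(* The limit [l] is kept as a sum of vanishing terms so that [cvg_big] can reach it termwise. *)
have := @big1 R 0 +%R _ (index_enum 'I_n) xpredT
  (fun i => `|phi i| * `|xi (v i) - xi (v i)|).
set l := \sum_(i < n) _ => l0.
have : \sum_(i < n) `|phi i| * `|xi (v i) - g psi (v i)| @[psi --> W] --> l.
  apply: cvg_big => [|i _]; first exact: add_continuous.
  apply: cvgM; first exact: cvg_cst.
  by apply: cvg_norm; apply: cvgB; [exact: cvg_cst|exact: xi_lim].
rewrite l0 => [/cvgrPdist_lt/(_ _ e4)|i _]; last by rewrite subrr normr0 mulr0.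
apply: filterS2 WK => psi Kpsi; rewrite sub0r normrN => /(le_lt_trans (ler_norm _)) h.
rewrite -((hg psi).2 Kpsi).
apply: (@le_lt_trans _ _ (e / 4 + 2 * (e / 4))); last by lra.
apply: opnorm_ler => [|x]; first by rewrite addr_ge0 ?mulr_ge0// ltW.
have -> : (op_comp xi D - op_comp (g psi) D) x =
    (xi - g psi) (rank_sum phi v x) + (xi - g psi) ((D - rank_sum phi v) x).
  rewrite -operatorD -[(D - _) x]/(D x - rank_sum phi v x).
  by rewrite (addrC (rank_sum phi v x)) subrK.
apply: (le_trans (ler_normD _ _)); rewrite mulrDl lerD//.
  rewrite rank_sumE operator_sum; apply: (le_trans (ler_norm_sum _ _ _)).
  apply: (@le_trans _ _ ((\sum_(i < n) `|phi i| * `|xi (v i) - g psi (v i)|) * `|x|)).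
    rewrite mulr_suml; apply: ler_sum => i _.
    rewrite functionalZ normrM mulrAC ler_wpM2r// ler_opnorm//.
  by rewrite ler_wpM2r// ltW.
apply: (le_trans (ler_opnorm _ _)); rewrite -mulrA ler_pM//.
  apply: (le_trans (ler_normB _ _)).
  by rewrite -[X in _ <= X]/(1 + 1) lerD// (hg psi).1.
by apply: (le_trans (ler_opnorm _ _)); rewrite ler_wpM2r// ltW.
Qed.

(** The approximation property gives a finite-rank [S0] close to the identity on the compact set of
    all [op_comp xi D]. Its coefficients [chi j] lie in the bidual of [E]. [helly] replaces them by
    vectors [x j]: only their action on the [op_comp xi D] counts, and [D] is nearly of finite
    rank. *)
Lemma approximation_property_dual E X (D : operator E X) (e : R) :
  approximation_property (dual E) -> approximable D -> 0 < e ->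
  exists n (psi : 'I_n -> dual E) (x : 'I_n -> E),
    `|D - op_comp D (rank_sum psi x)| <= e.
Proof.
move=> apE aD e0; have e2 : 0 < e / 2 by rewrite divr_gt0.
have [S0 /finite_rankE[n [chi [psi S0E]]] S0K] :=
  apE _ _ (compact_adjoint_ball aD) e2.
(* [C] collects the errors bounded in [hj] below, weighted by the [psi j]; the choice of [d] makes
   their total at most [e / 2]. *)
pose C := \sum_(j < n) `|psi j| * (2 * `|chi j| + 1).
have C0 : 0 <= C by apply: sumr_ge0 => j _; rewrite mulr_ge0// addr_ge0// mulr_ge0.
pose d := e / 2 / (1 + C).
have C1 : 0 < 1 + C by rewrite ltr_wpDr.
have d0 : 0 < d by rewrite divr_gt0.
have [D' /finite_rankE[m [phi [v D'E]]] DD'] := (approximableP D).1 aD d d0.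
pose M := \sum_(i < m) `|v i|.
have M1 : 0 < 1 + M by rewrite ltr_wpDr// sumr_ge0.
have /choice[x hx] : forall j, exists x : E, `|x| <= `|chi j| /\
    forall i, `|phi i x - chi j (phi i)| <= d / (1 + M).
  move=> j; have [x x1 x2] := helly (chi j) [seq phi i | i <- enum 'I_m]
    (divr_gt0 d0 M1).
  by exists x; split => // i; apply: x2; apply: map_f; rewrite mem_enum.
exists n, psi, x; apply: opnorm_ler => [|y]; first exact: ltW.
apply: norm_le_functional => xi xi1.
pose xiD : dual E := op_comp xi D.
have hj j : `|xiD (x j) - chi j xiD| <= d * (2 * `|chi j| + 1).
  pose xiD' : dual E := op_comp xi D'.
  have xiDD' : `|xiD - xiD'| <= d.
    apply: opnorm_ler => [|z]; first exact: ltW.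
    have -> : (xiD - xiD') z = xi ((D - D') z) by rewrite [RHS]operatorB.
    apply: (le_trans (ler_opnorm _ _)).
    apply: (@le_trans _ _ `|(D - D') z|); first by rewrite ler_piMl.
    by apply: (le_trans (ler_opnorm _ _)); rewrite ler_wpM2r// ltW.
  have xiD'E : xiD' = \sum_(i < m) xi (v i) *: phi i.
    apply: operatorP => z; rewrite sum_operatorE -[LHS]/(xi (D' z)) D'E rank_sumE.
    rewrite operator_sum; apply: eq_bigr => i _.
    by rewrite functionalZ mulrC.
  have -> : xiD (x j) - chi j xiD = (xiD - xiD') (x j) +
      (xiD' (x j) - chi j xiD') - chi j (xiD - xiD').
    rewrite (operatorB (chi j)) -[(xiD - xiD') (x j)]/(xiD (x j) - xiD' (x j)).
    ring.
  have h1 : `|(xiD - xiD') (x j)| <= d * `|chi j|.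
    by apply: (le_trans (ler_opnorm _ _)); rewrite ler_pM// (hx j).1.
  have h2 : `|chi j (xiD - xiD')| <= d * `|chi j|.
    by apply: (le_trans (ler_opnorm _ _)); rewrite mulrC ler_pM.
  have h3 : `|xiD' (x j) - chi j xiD'| <= d.
    rewrite xiD'E sum_operatorE operator_sum -sumrB.
    apply: (le_trans (ler_norm_sum _ _ _)).
    apply: (@le_trans _ _ (\sum_(i < m) `|v i| * (d / (1 + M)))).
      apply: ler_sum => i _; rewrite functionalZ -mulrBr normrM ler_pM//.
        by apply: (le_trans (ler_opnorm _ _)); rewrite ler_piMl.
      exact: (hx j).2.
    rewrite -mulr_suml mulrCA ler_piMr ?(ltW d0)// ler_pdivrMr// mul1r.
    by rewrite lerDr.
  apply: (le_trans (ler_normB _ _)).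
  have := ler_normD ((xiD - xiD') (x j)) (xiD' (x j) - chi j xiD').
  rewrite mulrDr mulr1 (mulrCA d); lra.
have -> : xi ((D - op_comp D (rank_sum psi x)) y) = - ((S0 xiD - xiD) y +
    \sum_(j < n) psi j y * (xiD (x j) - chi j xiD)).
  rewrite -[(D - _) y]/(D y - D (rank_sum psi x y)) rank_sumE.
  rewrite (operatorB xi).
  rewrite !operator_sum S0E rank_sumE.
  rewrite -[(_ - xiD) y]/((\sum_(i < n) chi i xiD *: psi i) y - xiD y).
  rewrite sum_operatorE addrAC -big_split/= opprB.
  congr (_ - _); apply: eq_bigr => j _.
  rewrite !operatorZ -[LHS]/(psi j y * xiD (x j)).
  rewrite -[RHS]/(chi j xiD * psi j y + psi j y * (xiD (x j) - chi j xiD)).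
  ring.
rewrite normrN; apply: (le_trans (ler_normD _ _)); rewrite (splitr e) mulrDl lerD//.
  apply: (le_trans (ler_opnorm _ _)); rewrite ler_wpM2r// S0K//.
  by exists xi.
apply: (le_trans (ler_norm_sum _ _ _)).
apply: (@le_trans _ _ (\sum_(j < n) `|psi j| * (2 * `|chi j| + 1) * d * `|y|)).
  apply: ler_sum => j _; rewrite normrM.
  have -> : `|psi j| * (2 * `|chi j| + 1) * d * `|y| =
    `|psi j| * `|y| * (d * (2 * `|chi j| + 1)) by ring.
  by rewrite ler_pM// ler_opnorm.
rewrite -!mulr_suml ler_wpM2r// -/C /d mulrCA ler_piMr ?(ltW e2)//.
by rewrite ler_pdivrMr// mul1r lerDr.
Qed.

(** The adjoint of the inclusion of [G] into its bidual projects the third dual of [G] onto the dual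
    of [G]; [Phi] and its inverse [Psi] transport this to [F]. *)
Lemma dual_space_projection F : dual_space F ->
  exists P : operator (dual (dual F)) F, forall y, P (canonical_inclusion F y) = y.
Proof.
move=> [G [Phi [Phi_isom /choice[psi psiE]]]].
have Phi_inj : injective Phi.
  move=> x y xy; apply/eqP; rewrite -subr_eq0 -normr_eq0 -Phi_isom operatorB xy.
  by rewrite subrr normr0.
have [a x y|x|Psi PsiE] := @operator_of_bound R F (dual G) psi 1.
- by apply: Phi_inj; rewrite operatorD operatorZ !psiE.
- by rewrite -Phi_isom psiE mul1r.
have [a x y|x|ev evE] := @operator_of_bound R G (dual F)
    (fun g => op_comp (canonical_inclusion G g) Psi) `|Psi|.
- by apply: operatorP => z; rewrite -[LHS]/(Psi z (a *: x + y)) operatorD operatorZ.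
- rewrite mulrC; apply: (le_trans (opnorm_comp _ _)).
  by rewrite canonical_inclusion_norm.
have [a x y|x|P PE] := @operator_of_bound R (dual (dual F)) F
    (fun z => Phi (op_comp z ev)) `|ev|.
- by rewrite -operatorZ -operatorD; congr (Phi _); exact: operatorP.
- by rewrite Phi_isom mulrC; exact: opnorm_comp.
exists P => y; rewrite PE -[RHS]psiE -PsiE; congr (Phi _).
by apply: operatorP => g; rewrite -[LHS]/(ev g y) evE.
Qed.

End ApproximationProperty.

(** * Norm estimates in a Banach operator ideal *)

Section Ideals.
Context (R : realType) (A : normed_class R).
Hypothesis hA : banach_operator_ideal A.
Implicit Types E F G X Y : completeNormedModType R.

(** [T] and [- T] have the same norm, and their sum has norm zero. *)
Lemma ideal_norm_ge0 E F (T : operator E F) : A E F T -> 0 <= ideal_norm A T.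
Proof.
move=> AT; have [AN nN] := idealZ hA (-1) AT.
have [_] := idealD hA AT AN; rewrite nN normrN normr1 mul1r scaleN1r subrr.
have := (idealZ hA 0 AT).2; rewrite scale0r normr0 mul0r => ->; lra.
Qed.

Definition point_fun F (v : F) (a : R) := a *: v.

Lemma point_bounded_linear F (v : F) :
  point_fun v \in @bounded_linear R R F.
Proof.
apply: (@bounded_linear_bound _ _ _ _ `|v|) => [a x y|x].
  by rewrite /point_fun scalerDl scalerA.
by rewrite /point_fun normrZ mulrC.
Qed.

Definition point F (v : F) : operator R F := Operator (point_bounded_linear v).

Lemma point_norm F (v : F) : `|point v| <= `|v|.
Proof. by apply: opnorm_ler => // a; rewrite mulrC -normrZ. Qed.

Lemma ideal_rank_one E F (phi : dual E) (v : F) :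
  A E F (rank_one phi v) /\ ideal_norm A (rank_one phi v) <= `|phi| * `|v|.
Proof.
have [Aid nid] := ideal_id hA.
have [h1 h2] := ideal_comp hA (point v) (phi : operator E R) Aid.
have <- : op_comp (point v) (op_comp (op_id R) (phi : operator E R)) =
  rank_one phi v by exact: operatorP.
split => //; apply: (le_trans h2); rewrite nid mulr1 mulrC.
by rewrite ler_wpM2l// point_norm.
Qed.

Lemma ideal_rank_sum E F n (phi : 'I_n -> dual E) (v : 'I_n -> F) :
  A E F (rank_sum phi v) /\
  ideal_norm A (rank_sum phi v) <= \sum_(i < n) `|phi i| * `|v i|.
Proof.
rewrite /rank_sum.
elim/big_ind2: _ => [|T a S b [AT Ta] [AS Sb]|i _].
- split; first exact: ideal0.
  by have := (idealZ hA 0 (ideal0 hA E F)).2; rewrite scale0r normr0 mul0r => ->.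
- have [h1 h2] := idealD hA AT AS; split => //.
  by apply: (le_trans h2); rewrite lerD.
- exact: ideal_rank_one.
Qed.

(** [T] between [point x] and [phi] is [phi (T x)] times the identity of [R], which has ideal norm
    one. *)
Lemma opnorm_le_ideal_norm E F (T : operator E F) :
  A E F T -> `|T| <= ideal_norm A T.
Proof.
move=> AT; apply: opnorm_ler => [|x]; first exact: ideal_norm_ge0.
apply: norm_le_functional => phi phi1.
have [h1 h2] := ideal_comp hA (phi : operator F R) (point x) AT.
have [Aid nid] := ideal_id hA.
have e : op_comp (phi : operator F R) (op_comp T (point x)) =
    phi (T x) *: (op_id R : operator R R).
  apply: operatorP => a; rewrite -[LHS]/(phi (T (a *: x))) operatorZ functionalZ.
  by rewrite mulrC.
have [_] := idealZ hA (phi (T x)) Aid.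
rewrite nid mulr1 -e => <-; apply: (le_trans h2).
rewrite ler_pM ?mulr_ge0 ?ideal_norm_ge0 ?point_norm//.
by rewrite ler_piMl ?ideal_norm_ge0.
Qed.

Lemma ideal_comp_left E F G (V : operator F G) (T : operator E F) :
  A E F T -> A E G (op_comp V T).
Proof.
move=> AT; have [h _] := ideal_comp hA V (op_id E) AT.
by have <- : op_comp V (op_comp T (op_id E)) = op_comp V T by exact: operatorP.
Qed.

Section BidualFactor.
Variables (E F G X Y : completeNormedModType R).
Variables (L : operator G (dual (dual F))) (V : operator Y G) (S : operator X Y).
Hypotheses (aV : approximable V) (AS : A X Y S).
Variables (n : nat) (psi : 'I_n -> dual E) (x : 'I_n -> X) (y : 'I_n -> F).
Hypothesis Lxy : forall j, L (V (S (x j))) = canonical_inclusion F (y j).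

(** If [L] had values in [F], composing it with [V], [S] and [N] would give the bound. Instead [V]
    is approximated by a finite-rank [V'], and [bidual_system] replaces the vectors [L (v i)] by
    [w i] in [F]. The resulting [W] has norm at most [|L| * |V|] up to order [d] and nearly maps
    [S (x j)] to [y j]; the remainder [Z] has ideal norm of order [d]. *)
Lemma ideal_norm_bidual_factor_approx : exists C, forall d, 0 < d -> d <= 1 ->
  ideal_norm A (rank_sum psi y) <=
    `|L| * `|V| * ideal_norm A S * `|rank_sum psi x| + d * C.
Proof.
pose N := rank_sum psi x; pose a := ideal_norm A S.
have a0 : 0 <= a by exact: ideal_norm_ge0.
pose C1 := `|L| * `|V| + 2 * `|L| + 3.
pose C2 j := 2 * (`|L| * `|S (x j)| + 1).
exists (C1 * a * `|N| + \sum_j `|psi j| * C2 j) => d d0 d1.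
have [V' /finite_rankE[m [eta [v V'E]]] VV'] := (approximableP V).1 aV d d0.
have d01 : 0 < 1 + d by rewrite ltr_wpDr// ltW.
(* [s i] will bound [|w i|]; it fixes the mesh [d / (1 + M)] of the net before [w] is known. *)
pose s i := (1 + d) * (`|L| * `|v i| + d).
have s0 i : 0 <= s i by rewrite mulr_ge0 ?(ltW d01)// addr_ge0 ?mulr_ge0// ltW.
pose M := \sum_i s i.
have M1 : 0 < 1 + M by rewrite ltr_wpDr// sumr_ge0.
have [K [z [z1 znet]]] := functional_net eta (divr_gt0 d0 M1).
pose coef (k : K + 'I_n + 'I_m) i := match k with
  | inl (inl l) => eta i (z l)
  | inl (inr j) => eta i (S (x j))
  | inr i' => (i == i')%:R end.
pose rhs (k : K + 'I_n + 'I_m) := if k is inl (inr j) then y j else 0.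
pose rad (k : K + 'I_n + 'I_m) := match k with
  | inl (inl l) => `|L| * (`|V| + d) + d
  | inl (inr j) => `|L| * (d * `|S (x j)|) + d
  | inr i' => `|L| * `|v i'| + d end.
have V'V : `|V'| <= `|V| + d.
  rewrite -(subrK V V') addrC; apply: (le_trans (ler_normD _ _)).
  by rewrite lerD2l distrC ltW.
have L_V' u : \sum_i eta i u *: L (v i) = L (V' u).
  rewrite V'E rank_sumE operator_sum; apply: eq_bigr => i _.
  by rewrite operatorZ.
have [|k|w hw] := @bidual_system R F 'I_m (K + 'I_n + 'I_m)%type coef rhs rad
    (fun i => L (v i)) _ _ d d0.
- by case=> [[l|j]|i'] /=; rewrite ltr_wpDl ?mulr_ge0 ?addr_ge0 ?mulr_ge0// ltW.
- case: k => [[l|j]|i'] /=.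
  + rewrite L_V' -[evaluation 0]/(canonical_inclusion F 0) operator0 sub0r normrN.
    apply: (@le_trans _ _ (`|L| * (`|V| + d))); last by rewrite lerDl ltW.
    apply: (le_trans (ler_opnorm _ _)); rewrite ler_wpM2l//.
    apply: (le_trans (ler_opnorm _ _)); apply: le_trans V'V.
    by rewrite ler_piMr.
  + rewrite L_V' -[evaluation _]/(canonical_inclusion F (y j)) -Lxy -operatorB.
    apply: (@le_trans _ _ (`|L| * (d * `|S (x j)|))); last by rewrite lerDl ltW.
    apply: (le_trans (ler_opnorm _ _)); rewrite ler_wpM2l//.
    rewrite -[V _ - V' _]/((V - V') (S (x j))).
    by apply: (le_trans (ler_opnorm _ _)); rewrite ler_wpM2r// ltW.
  + rewrite (bigD1 i')//= eqxx scale1r big1 ?addr0; last first.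
      by move=> i /negPf ->; rewrite scale0r.
    rewrite -[evaluation 0]/(canonical_inclusion F 0) operator0 sub0r normrN.
    by apply: (le_trans (ler_opnorm _ _)); rewrite lerDl ltW.
pose W := rank_sum eta w.
have w_s i : `|w i| <= s i.
  have := hw (inr i); rewrite /= (bigD1 i)//= eqxx scale1r big1 ?addr0.
    by rewrite sub0r normrN.
  by move=> i' /negPf ->; rewrite scale0r.
have W_net l : `|W (z l)| <= (1 + d) * (`|L| * (`|V| + d) + d).
  by have := hw (inl (inl l)); rewrite /= sub0r normrN -rank_sumE.
have W_y j : `|y j - W (S (x j))| <= d * C2 j.
  have := hw (inl (inr j)); rewrite /= -rank_sumE => /le_trans; apply.
  have : (1 + d) * (`|L| * (d * `|S (x j)|) + d) =
    (1 + d) * (d * (`|L| * `|S (x j)| + 1)) by ring.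
  move=> ->; rewrite /C2 mulrCA ler_wpM2l ?(ltW d0)// ler_wpM2r ?addr_ge0 ?mulr_ge0//.
  by rewrite -[leRHS]/(1 + 1) lerD2l.
have W_ball u : `|u| <= 1 -> `|W u| <= `|L| * `|V| + d * C1.
  move=> u1; have [l hl] := znet u u1.
  rewrite -(subrK (W (z l)) (W u)); apply: (le_trans (ler_normD _ _)).
  apply: (@le_trans _ _ (d + (1 + d) * (`|L| * (`|V| + d) + d))).
    rewrite lerD// -operatorB rank_sumE; apply: (le_trans (ler_norm_sum _ _ _)).
    apply: (@le_trans _ _ (\sum_i d / (1 + M) * s i)).
      by apply: ler_sum => i _; rewrite normrZ ler_pM// operatorB.
    rewrite -mulr_sumr -/M mulrAC -mulrA ler_piMr ?(ltW d0)//.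
    by rewrite ler_pdivrMr// mul1r lerDr.
  have L0 := normr_ge0 L; have V0 := normr_ge0 V.
  rewrite /C1; have : 0 <= (1 - d) * (d * (`|L| + 1)).
    by rewrite mulr_ge0 ?subr_ge0// mulr_ge0 ?(ltW d0)// addr_ge0.
  lra.
have C10 : 0 <= C1 by rewrite !addr_ge0// mulr_ge0.
have W_norm : `|W| <= `|L| * `|V| + d * C1.
  apply: opnorm_ler => [|u].
    by rewrite addr_ge0 ?mulr_ge0// ltW.
  have [->|u0] := eqVneq u 0; first by rewrite operator0 !normr0 mulr0.
  have nu : 0 < `|u| by rewrite normr_gt0.
  have := W_ball (`|u|^-1 *: u).
  rewrite operatorZ !normrZ normfV normr_id mulVf ?gt_eqF// => /(_ (lexx _)).
  by rewrite mulrC ler_pdivrMr.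
pose Z := rank_sum psi (fun j => y j - W (S (x j))).
have KE : rank_sum psi y = op_comp W (op_comp S N) + Z.
  apply: operatorP => u.
  have NE : N u = \sum_j psi j u *: x j by exact: rank_sumE.
  have ZE : Z u = \sum_j psi j u *: (y j - W (S (x j))) by exact: rank_sumE.
  rewrite -[RHS]/(W (S (N u)) + Z u) NE ZE (operator_sum S) (operator_sum W).
  rewrite rank_sumE -big_split; apply: eq_bigr => j _ /=.
  by rewrite (operatorZ S) (operatorZ W) scalerBr addrC subrK.
have [AZ nZ] := ideal_rank_sum psi (fun j => y j - W (S (x j))).
have [AW nW] := ideal_comp hA W N AS.
rewrite KE; apply: (le_trans (idealD hA AW AZ).2).
apply: (@le_trans _ _ ((`|L| * `|V| + d * C1) * a * `|N| +
    d * \sum_j `|psi j| * C2 j)).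
  apply: lerD.
    by apply: (le_trans nW); rewrite ler_wpM2r// ler_wpM2r.
  apply: (le_trans nZ); rewrite mulr_sumr; apply: ler_sum => j _.
  by rewrite mulrCA ler_wpM2l.
by rewrite -/a -/N le_eqVlt; apply/orP; left; apply/eqP; ring.
Qed.

Lemma ideal_norm_bidual_factor : ideal_norm A (rank_sum psi y) <=
  `|L| * `|V| * ideal_norm A S * `|rank_sum psi x|.
Proof.
have [C hC] := ideal_norm_bidual_factor_approx.
apply/ler_addgt0Pr => e e0; have C1 : 0 < `|C| + 1 by rewrite ltr_wpDl.
pose d := Num.min 1 (e / (`|C| + 1)).
have d0 : 0 < d by rewrite lt_min ltr01 divr_gt0.
have d1 : d <= 1 by rewrite ge_min lexx.
have de : d <= e / (`|C| + 1) by rewrite ge_min lexx orbT.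
apply: (le_trans (hC d d0 d1)); rewrite lerD2l.
apply: (@le_trans _ _ (d * (`|C| + 1))); last by rewrite -ler_pdivlMr.
by rewrite ler_wpM2l ?(ltW d0)//; have := ler_norm C; lra.
Qed.

End BidualFactor.

(* [T Q_k] with [D Q_k -> D] is Cauchy for the ideal norm by
   [ideal_norm_bidual_factor], although no extension of [T] along [V S D] has
   values in [F]. *)
Lemma ideal_mem_of_bidual_factor E F G X Y (T : operator E F)
    (L : operator G (dual (dual F))) (V : operator Y G) (S : operator X Y)
    (D : operator E X) :
  approximation_property (dual E) -> approximable D -> approximable V ->
  A X Y S -> (forall x, L (V (S (D x))) = canonical_inclusion F (T x)) ->
  A E F T.
Proof.
move=> apE aD aV AS LT.
pose e k : R := k.+1%:R^-1.
have e0 k : 0 < e k by rewrite invr_gt0.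
have /choice[Q hQ] : forall k, exists Q : operator E E, finite_rank Q /\
    `|D - op_comp D Q| <= e k.
  move=> k; have [n [psi [x hx]]] := approximation_property_dual apE aD (e0 k).
  by exists (rank_sum psi x); split => //; exact: rank_sum_finite_rank.
have T_rank n (psi : 'I_n -> dual E) x :
    op_comp T (rank_sum psi x) = rank_sum psi (fun j => T (x j)).
  apply: operatorP => u; rewrite rank_sumE -[LHS]/(T (rank_sum psi x u)).
  by rewrite rank_sumE operator_sum; apply: eq_bigr => j _; rewrite operatorZ.
have AT_fin (P : operator E E) : finite_rank P -> A E F (op_comp T P).
  by move=> /finite_rankE[n [psi [x ->]]]; rewrite T_rank; exact: (ideal_rank_sum _ _).1.
have AT_norm (P : operator E E) : finite_rank P -> ideal_norm A (op_comp T P) <=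
    `|L| * `|V| * ideal_norm A S * `|op_comp D P|.
  move=> /finite_rankE[n [psi [x ->]]]; rewrite T_rank.
  have -> : op_comp D (rank_sum psi x) = rank_sum psi (fun j => D (x j)).
    apply: operatorP => u; rewrite rank_sumE -[LHS]/(D (rank_sum psi x u)).
    by rewrite rank_sumE operator_sum; apply: eq_bigr => j _; rewrite operatorZ.
  by apply: ideal_norm_bidual_factor => // j; exact: LT.
pose c := `|L| * `|V| * ideal_norm A S.
have c0 : 0 <= c by rewrite !mulr_ge0// ideal_norm_ge0.
have c1 : 0 < c + 1 by rewrite ltr_wpDl.
have e_small (d : R) : 0 < d -> exists K, forall k, (K <= k)%N -> e k <= d.
  move=> d0; exists (Num.truncn d^-1) => k Kk.
  rewrite /e -[d]invrK lef_pV2 ?posrE ?invr_gt0//.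
  by apply: (le_trans (ltW (truncnS_gt _))); rewrite ler_nat.
have [|d d0|T' AT' T'lim] := ideal_complete_norm hA (u := fun k => op_comp T (Q k)).
- by move=> k; apply: AT_fin; exact: (hQ k).1.
- have [K hK] := e_small (d / (c + 1) / 2)
    (divr_gt0 (divr_gt0 d0 c1) (ltr0n R 2)).
  exists K => m n Km Kn.
  have -> : op_comp T (Q m) - op_comp T (Q n) = op_comp T (Q m - Q n).
    by apply: operatorP => x; rewrite -[RHS]/(T (Q m x - Q n x)) operatorB.
  apply: (le_trans (AT_norm _ (finite_rankB (hQ m).1 (hQ n).1))); rewrite -/c.
  have : `|op_comp D (Q m - Q n)| <= d / (c + 1).
    have -> : op_comp D (Q m - Q n) =
        (D - op_comp D (Q n)) - (D - op_comp D (Q m)).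
      apply: operatorP => x.
      rewrite -[LHS]/(D (Q m x - Q n x)) operatorB.
      rewrite -[RHS]/((D x - D (Q n x)) - (D x - D (Q m x))).
      by rewrite opprB [RHS]addrC addrA subrK.
    apply: (le_trans (ler_normB _ _)); rewrite (splitr (d / _)); apply: lerD.
      exact: le_trans (hQ n).2 (hK n Kn).
    exact: le_trans (hQ m).2 (hK m Km).
  move=> h; apply: (@le_trans _ _ ((c + 1) * (d / (c + 1)))).
    by rewrite ler_pM// lerDl.
  by rewrite mulrC divfK// gt_eqF.
(* [T'] is also a pointwise limit, since the ideal norm dominates the operator norm; and [T (Q k x)]
   tends to [T x] because the canonical inclusion after [T] factors through [D]. *)
suff -> : T = T' by [].
apply: operatorP => x.
have T'x : op_comp T (Q k) x @[k --> \oo] --> T' x.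
  apply/cvgrPdist_le => d d0.
  have x1 : 0 < `|x| + 1 by rewrite ltr_wpDl.
  move/cvgrPdist_le : T'lim => /(_ (d / (`|x| + 1)) (divr_gt0 d0 x1)).
  apply: filterS => k; rewrite sub0r normrN => /(le_trans (ler_norm _)) h.
  rewrite distrC -[op_comp T (Q k) x - T' x]/((op_comp T (Q k) - T') x).
  apply: (le_trans (ler_opnorm _ _)).
  have AQ : A E F (op_comp T (Q k) - T').
    have := (idealD hA (AT_fin _ (hQ k).1) (idealZ hA (-1) AT').1).1.
    by rewrite scaleN1r.
  apply: (@le_trans _ _ (d / (`|x| + 1) * (`|x| + 1))).
    by rewrite ler_pM ?lerDl//; exact: le_trans (opnorm_le_ideal_norm AQ) h.
  by rewrite divfK// gt_eqF.
apply: (cvg_unique _ _ T'x) => //.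
apply/cvgrPdist_le => d d0.
pose C := `|op_comp L (op_comp V S)| * `|x|.
have C0 : 0 <= C by rewrite mulr_ge0.
have C1 : 0 < C + 1 by rewrite ltr_wpDl.
have [K hK] := e_small (d / (C + 1)) (divr_gt0 d0 C1).
exists K => // k /= Kk; rewrite -canonical_inclusion_norm operatorB -!LT.
have -> : L (V (S (D x))) - L (V (S (D (Q k x)))) =
    op_comp L (op_comp V S) ((D - op_comp D (Q k)) x).
  by rewrite [RHS](operatorB (op_comp L (op_comp V S))).
apply: (le_trans (ler_opnorm _ _)).
apply: (@le_trans _ _ (C * e k)).
  rewrite /C -mulrA ler_wpM2l//; apply: (le_trans (ler_opnorm _ _)).
  by rewrite mulrC ler_wpM2l// (hQ k).2.
apply: (@le_trans _ _ ((C + 1) * (d / (C + 1)))).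
  by rewrite ler_pM ?(ltW (e0 k)) ?lerDl ?hK.
by rewrite mulrC divfK// gt_eqF.
Qed.

End Ideals.

(** * The theorem: one bidual factorization, four alternatives *)

Theorem theorem2p7 (R : realType) (E F : completeNormedModType R)
  (A : normed_class R) (hA : banach_operator_ideal A) (hmin : minimal_ideal A)
  (T : operator E F) (G1 G2 : completeNormedModType R)
  (f1 : E -> G1) (f2 : G2 -> F) (S : operator G1 G2)
  (hf1 : Lip0 f1) (hf2 : Lip0 f2) (hS : A G1 G2 S)
  (hT : (T : E -> F) = f2 \o S \o f1)
  (hE : separable E)
  (hab : weakly_compact_Lip0 f2 \/
    (dual_space F \/ approximation_property (dual E) \/ regular_ideal A)) :
  A E F T.
Proof.
have [X [Y [V [S0 [U [aV AS0 aU SE]]]]]] := (hmin _ _ S).1.1 hS.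
have [D [L [aD LT Lweak]]] := lipschitz_factor_bidual hf1 hf2 hT SE aU.
(* [B] lies in [A], and [L] after [B] is [T] followed by the canonical inclusion. Three alternatives
   conclude by the ideal property from [B]; the approximation property uses the Cauchy argument
   instead. *)
pose B := op_comp V (op_comp S0 D).
have AB : A E G2 B by exact: (ideal_comp hA V D AS0).1.
case: hab => [wf2|[dF|[apE|regA]]].
- have [K LK] := bidual_range_operator (Lweak wf2).
  have -> : T = op_comp K B; last exact: ideal_comp_left.
  apply: operatorP => x; apply/eqP; rewrite -subr_eq0 -normr_eq0.
  by rewrite -canonical_inclusion_norm operatorB -LT -LK subrr normr0.
- have [P PJ] := dual_space_projection dF.
  have -> : T = op_comp (op_comp P L) B; last exact: ideal_comp_left.
  by apply: operatorP => x; rewrite -[LHS]PJ -LT.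
- exact: (ideal_mem_of_bidual_factor hA apE aD aV AS0 LT).
- apply: (regA _ _ T).1.2.
  have JT : op_comp (canonical_inclusion F) T = op_comp L B.
    by apply: operatorP => x; rewrite -[LHS]LT.
  by rewrite /regular_hull/= JT; exact: ideal_comp_left.
Qed.
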